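(* Let $(x_i,f_i)_{i\in\mathbb{N}}\subset X\times X^*$ be a Schauder frame of a Banach space $X$ and assume that for all $m\in\mathbb{N}$ $$\lim_{n\to\infty}\big\|f_m|_{\mathrm{span}(x_i:i\ge n)}\big\|=0\quad\text{and}\quad \lim_{n\to\infty}\big\|x_m|_{\mathrm{span}(f_i:i\ge n)}\big\|=0.$$ Then the following are equivalent. (1) $(x_i,f_i)$ is boundedly complete. (2) $X$ is isomorphic to $\overline{\mathrm{span}(f_i:i\in\mathbb{N})}^{\,*}$ (the dual of the norm closed span of $(f_i)$ in $X^*$) under the natural canonical map; that is, with $Y=\overline{\mathrm{span}(f_i:i\in\mathbb{N})}$, the map $J:X\to Y^*$, $J(x)(f)=f(x)$, is an isomorphism onto $Y^*$. (3) The maximal associated basis $(e_i^{Max})$ to $(x_i,f_i)$ is a boundedly complete basis of the maximal associated space $Z_{Max}$.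
   Context: All Banach spaces are over $\mathbb{R}$. $c_{00}$ is the space of eventually vanishing scalar sequences, with unit vector basis $(e_i)$. Let $X$ be a separable Banach space. A sequence $(x_i,f_i)_{i\in\mathbb{N}}$ with $x_i\in X$, $f_i\in X^*$ is a (Schauder) frame of $X$ if for every $x\in X$, $x=\sum_{i=1}^\infty f_i(x)x_i$ with norm convergence of the partial sums. Convention: $x_i\ne 0$ and $f_i\neq 0$ for all $i$. For $f\in X^*$ and a subspace $E\subset X$, $\|f|_E\|$ is the norm of the restriction of $f$ to $E$; for $x\in X$ and a subspace $F\subset X^*$, $\|x|_F\|$ is the norm of the restriction to $F$ of $x$ viewed as an element of $X^{**}$. The frame $(x_i,f_i)$ is locally shrinking if for all $m$, $\|f_m|_{\mathrm{span}(x_i:i\ge n)}\|\to 0$ as $n\to\infty$; locally boundedly complete if for all $m$, $\|x_m|_{\mathrm{span}(f_i:i\ge n)}\|\to 0$ as $n\to\infty$; weakly localized if it is locally shrinking and locally boundedly complete; pre-boundedly complete if for all $x^{**}\in X^{**}$ the series $\sum_{i=1}^\infty x^{**}(f_i)x_i$ converges in norm; boundedly complete if it is weakly localized and pre-boundedly complete. Maximal space and basis with respect to $(x_i,f_i)$: $Z_{Max}$ is the completion of $c_{00}$ under the norm $$\Big\|\sum a_ie_i\Big\|_{Max}=\sup\Big\{\Big|\sum a_ib_i\Big| : (b_i)\in c_{00},\ \max_{m\le n}\Big\|\sum_{i=m}^n b_if_i\Big\|\le 1\Big\};$$ the unit vectors form a basis of $Z_{Max}$, denoted $(e_i^{Max})$.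 When the frame is locally boundedly complete these are called the maximal associated space and maximal associated basis. A basis $(z_i)$ is boundedly complete if $\sum a_iz_i$ converges whenever its partial sums are bounded. *)

(* Defs.v *)
From HB Require Import structures.
From mathcomp Require Import all_boot all_order all_algebra generic_quotient.
From mathcomp Require Import boolp classical_sets functions reals.
From mathcomp Require Import topology normedtype sequences.

Set Implicit Arguments.
Unset Strict Implicit.
Unset Printing Implicit Defensive.

Import Order.TTheory GRing.Theory Num.Theory.
Import numFieldNormedType.Exports.

Local Open Scope classical_set_scope.
Local Open Scope ring_scope.

Section Dual.
Context {R : realType} (V : normedModType R).

Definition dual_pred : {pred V -> R^o} :=
  fun f => `[< linear f /\ continuous f >].

Record dual : Type := Dual { dual_fun :> V -> R^o; dualP : dual_fun \in dual_pred }.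

HB.instance Definition _ := [isSub for dual_fun].
HB.instance Definition _ := [Choice of dual by <:].

Lemma dual_submod_closed : submod_closed dual_pred.
Proof.
split=> [|a f g /asboolP [lf cf] /asboolP [lg cg]]; apply/asboolP; split.
- by move=> b u v /=; rewrite scaler0 addr0.
- by move=> x; exact: cst_continuous.
- move=> b u v; have -> w : (a *: f + g) w = a *: f w + g w by [].
  by rewrite lf lg !scalerDr !scalerA (mulrC a) addrACA.
- move=> x; apply: (@continuousD _ R^o V (a \*: f) g); last exact: cg.
  by apply: (@continuousZl_tmp _ R^o V); exact: cf.
Qed.

HB.instance Definition _ :=
  GRing.SubChoice_isSubLmodule.Build R _ dual_pred dual dual_submod_closed.

Lemma dual_linear (f : dual) : linear f.
Proof. by have /asboolP[] := dualP f. Qed.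

HB.instance Definition _ (f : dual) := GRing.isLinear.Build R V R^o *:%R
  (dual_fun f) (@dual_linear f).

Lemma dual_continuous (f : dual) : continuous f.
Proof. by have /asboolP[] := dualP f. Qed.

Lemma dual_addE (f g : dual) v : (f + g) v = f v + g v. Proof. by []. Qed.
Lemma dual_scaleE (a : R) (f : dual) v : (a *: f) v = a *: f v. Proof. by []. Qed.

(* ||f|_E||, for E a linear subspace of V *)
Definition restr_norm (f : dual) (E : set V) : R :=
  sup [set `|f v| | v in E `&` [set v | `|v| <= 1]].

Lemma dual_bounded (f : dual) : exists2 M, 0 <= M & forall v, `|f v| <= M * `|v|.
Proof.
have /(@continuous_linear_bounded R V R^o 0 f)/linear_boundedP :=
  @dual_continuous f 0.
move=> /pinfty_ex_gt0 [M M0 fM]; exists M => //; exact: ltW.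
Qed.

Lemma restr_norm_has_sup (f : dual) (E : set V) : E 0 ->
  has_sup [set `|f v| | v in E `&` [set v | `|v| <= 1]].
Proof.
move=> E0; split; first by exists `|f 0|; exists 0 => //; split=> //=; rewrite normr0.
have [M M0 fM] := dual_bounded f; exists M => _ [v [_ /= v1] <-].
by rewrite (le_trans (fM v))// ler_piMr.
Qed.

Lemma restr_normP (f : dual) (E : set V) v : E v -> E 0 -> (forall a, E (a *: v)) ->
  `|f v| <= restr_norm f E * `|v|.
Proof.
move=> Ev E0 EZ; have [->|v0] := eqVneq v 0.
  by rewrite linear0 !normr0 mulr0.
rewrite -ler_pdivrMr ?normr_gt0//.
apply: (sup_upper_bound (restr_norm_has_sup f E0)).
exists (`|v|^-1 *: v); first split => //=.
  by rewrite normrZ normfV normr_id mulVf ?normr_eq0.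
by rewrite linearZ/= normrZ normfV normr_id mulrC.
Qed.

Lemma restr_norm_le (f : dual) (E : set V) M : E 0 -> 0 <= M ->
  (forall v, E v -> `|f v| <= M * `|v|) -> restr_norm f E <= M.
Proof.
move=> E0 M0 fM; apply: ge_sup; first exact: (restr_norm_has_sup f E0).1.
by move=> _ [v [Ev /= v1] <-]; rewrite (le_trans (fM _ Ev))// ler_piMr.
Qed.

Definition dual_norm (f : dual) : R := restr_norm f setT.

Lemma dual_norm_bound (f : dual) v : `|f v| <= dual_norm f * `|v|.
Proof. exact: restr_normP. Qed.

Lemma dual_norm_ge0 (f : dual) : 0 <= dual_norm f.
Proof.
apply: (sup_upper_bound (restr_norm_has_sup f (E := setT) I)).
by exists 0; [split=> //=; rewrite normr0|rewrite linear0 normr0].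
Qed.

Lemma ler_dual_normD (f g : dual) : dual_norm (f + g) <= dual_norm f + dual_norm g.
Proof.
apply: restr_norm_le => // [|v _]; first by rewrite addr_ge0// dual_norm_ge0.
by rewrite mulrDl (le_trans (ler_normD _ _))// lerD// dual_norm_bound.
Qed.

Lemma ler_dual_normZ a (f : dual) : dual_norm (a *: f) <= `|a| * dual_norm f.
Proof.
apply: restr_norm_le => // [|v _]; first by rewrite mulr_ge0// dual_norm_ge0.
by rewrite dual_scaleE normrZ -mulrA ler_wpM2l// dual_norm_bound.
Qed.

Lemma dual_normZ a (f : dual) : dual_norm (a *: f) = `|a| * dual_norm f.
Proof.
have [->|a0] := eqVneq a 0.
  rewrite normr0 mul0r; apply/le_anti; rewrite dual_norm_ge0 andbT.
  by have := ler_dual_normZ 0 f; rewrite normr0 mul0r.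
apply/le_anti; rewrite ler_dual_normZ/= -ler_pdivlMl ?normr_gt0//.
by have := ler_dual_normZ a^-1 (a *: f); rewrite scalerA mulVf// scale1r normfV.
Qed.

Lemma dual_norm0_eq0 (f : dual) : dual_norm f = 0 -> f = 0.
Proof.
move=> f0; apply/val_inj/funext => v; apply/eqP; rewrite -normr_le0.
by rewrite (le_trans (dual_norm_bound f v))// f0 mul0r.
Qed.

HB.instance Definition _ :=
  Lmodule_isNormed.Build R dual ler_dual_normD dual_normZ dual_norm0_eq0.

End Dual.

Lemma dual_normE (R : realType) (V : normedModType R) (f : dual V) :
  `|f| = restr_norm f setT.
Proof. by []. Qed.

Section Completion.
Local Open Scope quotient_scope.
Context {R : realType} (V : normedModType R).

Definition cauchy_pred : {pred nat -> V} := fun u =>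
  `[< forall e : R, 0 < e ->
      exists N : nat, forall m n : nat, (N <= m)%N -> (N <= n)%N -> `|u m - u n| < e >].

Record cauchy_seq : Type :=
  CauchySeq { cauchy_seq_fun :> nat -> V; cauchy_seqP : cauchy_seq_fun \in cauchy_pred }.

HB.instance Definition _ := [isSub for cauchy_seq_fun].
HB.instance Definition _ := [Choice of cauchy_seq by <:].

Lemma cauchy_submod_closed : submod_closed cauchy_pred.
Proof.
split=> [|a u v /asboolP cu /asboolP cv]; apply/asboolP => e e0.
  by exists 0%N => m n _ _; rewrite subrr normr0.
have e2 : 0 < e / 2 by rewrite divr_gt0.
have a1 : 0 < `|a| + 1 by rewrite ltr_wpDl.
have [N1 H1] := cu (e / 2 / (`|a| + 1)) (divr_gt0 e2 a1).
have [N2 H2] := cv _ e2.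
exists (maxn N1 N2) => m n; rewrite !geq_max => /andP[m1 m2] /andP[n1 n2].
have -> : (a *: u + v) m - (a *: u + v) n = a *: (u m - u n) + (v m - v n).
  by rewrite !fctE /= scalerBr opprD addrACA.
rewrite (le_lt_trans (ler_normD _ _))// [ltRHS]splitr ler_ltD//; last exact: H2.
rewrite normrZ; have /ltW uN := H1 m n m1 n1.
rewrite (le_trans (ler_wpM2l (normr_ge0 a) uN))// mulrA ler_pdivrMr// mulrC.
by rewrite ler_wpM2l ?lerDl// ltW.
Qed.

HB.instance Definition _ := GRing.SubChoice_isSubLmodule.Build R _ cauchy_pred
  cauchy_seq cauchy_submod_closed.

Definition lim_norm (u : cauchy_seq) : R := limn (fun n => `|u n|).

Lemma lim_norm_cvg (u : cauchy_seq) : (fun n => `|u n|) @ \oo --> lim_norm u.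
Proof.
have /asboolP cu := cauchy_seqP u.
apply/(@cauchy_cvgP R)/cauchy_exP => e e0; have [N HN] := cu e e0.
exists `|u N|; exists N => // n /= Nn.
by rewrite /ball/= (le_lt_trans (ler_dist_dist _ _))// HN.
Qed.

Lemma lim_norm_le (u : cauchy_seq) M :
  (\forall n \near \oo, `|u n| <= M) -> lim_norm u <= M.
Proof.
move=> uM; apply: limr_le uM; apply/cvg_ex; exists (lim_norm u); exact: lim_norm_cvg.
Qed.

Lemma lim_norm_ge0 (u : cauchy_seq) : 0 <= lim_norm u.
Proof.
apply: limr_ge; last exact: nearW.
by apply/cvg_ex; exists (lim_norm u); exact: lim_norm_cvg.
Qed.

Lemma ler_lim_normD (u v : cauchy_seq) :
  lim_norm (u + v) <= lim_norm u + lim_norm v.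
Proof.
have cD : (fun n => `|u n|) \+ (fun n => `|v n|) @ \oo --> lim_norm u + lim_norm v.
  by apply: cvgD; exact: lim_norm_cvg.
apply: (ler_cvg_to (@lim_norm_cvg (u + v)) cD).
by apply: nearW => n; exact: ler_normD.
Qed.

Lemma lim_normZ a (u : cauchy_seq) : lim_norm (a *: u) = `|a| * lim_norm u.
Proof.
apply/cvg_lim => //.
rewrite (_ : (fun n => _) = (fun n => `|a| * `|u n|)); last first.
  by apply/funext => n; exact: normrZ.
by apply: cvgMl_tmp; exact: lim_norm_cvg.
Qed.

Lemma lim_norm0 : lim_norm 0 = 0.
Proof. by rewrite -(scale0r 0) lim_normZ normr0 mul0r. Qed.

Lemma lim_normN u : lim_norm (- u) = lim_norm u.
Proof. by rewrite -scaleN1r lim_normZ normrN1 mul1r. Qed.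

Definition null_pred : {pred cauchy_seq} := fun u => lim_norm u == 0.

Lemma null_zmod_closed : zmod_closed null_pred.
Proof.
split=> [|u v]; rewrite !unfold_in ?lim_norm0// => /eqP u0 /eqP v0.
by rewrite eq_le lim_norm_ge0 andbT (le_trans (ler_lim_normD _ _))// lim_normN u0 v0 addr0.
Qed.

HB.instance Definition _ := GRing.isZmodClosed.Build cauchy_seq null_pred null_zmod_closed.

(* Cauchy sequences of V modulo null sequences; [to_completion] is a linear
   isometry of V onto a dense subspace. *)
Definition completion : Type := Quotient.quot null_pred.
HB.instance Definition _ := GRing.Zmodule.on completion.
HB.instance Definition _ : EqQuotient cauchy_seq (Quotient.equiv null_pred) completion :=
  EqQuotient.on completion.

Lemma completion_eq (u v : cauchy_seq) :
  (\pi_completion u = \pi_completion v) <-> lim_norm (u - v) = 0.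
Proof.
split=> [/eqP|uv]; last (apply/eqP; move: uv => /eqP).
  by rewrite -[_ == _](Quotient.idealrBE null_pred) => /eqP.
by move=> uv; rewrite -[_ == _](Quotient.idealrBE null_pred).
Qed.

Lemma completion_piD (u v : cauchy_seq) :
  \pi_completion (u + v) = \pi_completion u + \pi_completion v.
Proof. exact: (Quotient.pi_add null_pred). Qed.

Lemma completion_piN (u : cauchy_seq) : \pi_completion (- u) = - \pi_completion u.
Proof. exact: (Quotient.pi_opp null_pred). Qed.

Definition completion_scale (a : R) (z : completion) : completion :=
  \pi_completion (a *: repr z).

Lemma completion_scale_pi a (u : cauchy_seq) :
  completion_scale a (\pi_completion u) = \pi_completion (a *: u).
Proof.
apply/completion_eq; rewrite -scalerBr lim_normZ.
by rewrite (proj1 (completion_eq _ _) (reprK (\pi_completion u))) mulr0.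
Qed.

Lemma completion_scaleA a b z :
  completion_scale a (completion_scale b z) = completion_scale (a * b) z.
Proof. by rewrite -(reprK z) (completion_scale_pi b) !completion_scale_pi scalerA. Qed.
Lemma completion_scale1 : left_id 1 completion_scale.
Proof. by move=> z; rewrite -(reprK z) completion_scale_pi scale1r. Qed.
Lemma completion_scaleDr : right_distributive completion_scale +%R.
Proof.
move=> a z t; rewrite -(reprK z) -(reprK t) -completion_piD !completion_scale_pi.
by rewrite scalerDr completion_piD.
Qed.
Lemma completion_scaleDl z : {morph completion_scale^~ z : a b / a + b}.
Proof.
by move=> a b /=; rewrite -(reprK z) !completion_scale_pi scalerDl completion_piD.
Qed.

HB.instance Definition _ := GRing.Zmodule_isLmodule.Build R completion
  completion_scaleA completion_scale1 completion_scaleDr completion_scaleDl.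

Definition completion_norm (z : completion) : R := lim_norm (repr z).

Lemma completion_norm_pi (u : cauchy_seq) :
  completion_norm (\pi_completion u) = lim_norm u.
Proof.
have le_norm (s t : cauchy_seq) : \pi_completion s = \pi_completion t ->
    lim_norm s <= lim_norm t.
  move=> /completion_eq st; rewrite -[s](subrK t).
  by rewrite (le_trans (ler_lim_normD _ _))// st add0r.
by apply/le_anti/andP; split; apply: le_norm; rewrite ?reprK.
Qed.

Lemma ler_completion_normD z t :
  completion_norm (z + t) <= completion_norm z + completion_norm t.
Proof.
rewrite -(reprK z) -(reprK t) -completion_piD !completion_norm_pi.
exact: ler_lim_normD.
Qed.
Lemma completion_normZ a z : completion_norm (a *: z) = `|a| * completion_norm z.
Proof.
rewrite -(reprK z) [a *: _](completion_scale_pi a).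
by rewrite !completion_norm_pi lim_normZ.
Qed.
Lemma completion_norm0_eq0 z : completion_norm z = 0 -> z = 0.
Proof.
rewrite -(reprK z) completion_norm_pi => z0.
have <- : \pi_completion (0 : cauchy_seq) = 0.
  by rewrite -(subrr (0 : cauchy_seq)) completion_piD completion_piN subrr.
by apply/completion_eq; rewrite subr0.
Qed.

HB.instance Definition _ := Lmodule_isNormed.Build R completion
  ler_completion_normD completion_normZ completion_norm0_eq0.

Lemma cst_cauchy (v : V) : (fun _ : nat => v) \in cauchy_pred.
Proof. by apply/asboolP => e e0; exists 0%N => m n _ _; rewrite subrr normr0. Qed.

Definition to_completion (v : V) : completion :=
  \pi_completion (CauchySeq (cst_cauchy v)).

Lemma to_completion_linear : linear to_completion.
Proof.
move=> a u v; rewrite [X in _ = X + _](completion_scale_pi a) -completion_piD.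
by congr (\pi_completion _); apply/val_inj.
Qed.

HB.instance Definition _ := GRing.isLinear.Build R V completion *:%R
  to_completion to_completion_linear.

Lemma to_completion_norm v : `|to_completion v| = `|v|.
Proof.
by rewrite [LHS]completion_norm_pi; apply: cvg_lim => //; exact: (@cvg_cst R `|v|).
Qed.

Lemma completion_pi_cvg (u : cauchy_seq) e : 0 < e ->
  \forall n \near \oo, `|\pi_completion u - to_completion (u n)| <= e.
Proof.
move=> e0; have /asboolP /(_ e e0) [N HN] := cauchy_seqP u.
exists N => // n /= Nn; rewrite -completion_piN -completion_piD [leLHS]completion_norm_pi.
by apply: lim_norm_le; exists N => // m /= Nm; exact/ltW/HN.
Qed.

Lemma to_completion_dense z e : 0 < e -> exists v, `|z - to_completion v| <= e.
Proof.
move=> e0; have [N _ HN] := completion_pi_cvg (repr z) e0.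
by exists (repr z N); have := HN N (leqnn N); rewrite /= reprK.
Qed.

Lemma completion_complete (F : set_system completion) :
  ProperFilter F -> cauchy F -> cvg F.
Proof.
move=> FF /cauchyP Fc.
pose d n : R := n.+1%:R^-1.
have d0 n : 0 < d n by rewrite invr_gt0.
have /choice [c cF] n : exists c, F (ball c (d n)) := Fc _ (d0 n).
have /choice [v vc] n : exists v, `|c n - to_completion v| <= d n :=
  to_completion_dense (c n) (d0 n).
have dN n e : 0 < e -> (e^-1 < n.+1%:R) -> d n < e.
  by move=> e0 en; rewrite /d invf_plt ?posrE.
have d_small e : 0 < e -> exists N, forall n, (N <= n)%N -> d n < e.
  move=> e0; exists (Num.bound e^-1) => n Nn; apply: dN => //.
  apply: (@lt_le_trans _ _ (Num.bound e^-1)%:R); last by rewrite ler_nat leqW.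
  by rewrite archi_boundP// invr_ge0 ltW.
have cc m n : `|c m - c n| <= d m + d n.
  have [z [zm zn]] := filter_ex (filterI (cF m) (cF n)).
  rewrite -(subrKA z) (le_trans (ler_normD _ _))// lerD//.
    by move: zm; rewrite -ball_normE => /ltW.
  by move: zn; rewrite -ball_normE => /ltW; rewrite distrC.
have vcauchy : v \in cauchy_pred.
  apply/asboolP => e e0; have [N HN] := d_small (e / 4) ltac:(by rewrite divr_gt0).
  exists N => m n Nm Nn; rewrite -to_completion_norm linearB/=.
  have -> : to_completion (v m) - to_completion (v n) =
     (to_completion (v m) - c m) + (c m - c n) + (c n - to_completion (v n)).
    by rewrite !subrKA.
  rewrite (le_lt_trans (ler_normD _ _))//.
  rewrite (le_lt_trans (lerD (ler_normD _ _) (vc n)))// distrC.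
  rewrite (le_lt_trans (lerD (lerD (vc m) (cc m n)) (lexx _)))//.
  have dm := HN _ Nm; have dn := HN _ Nn.
  rewrite (_ : e = e / 4 + (e / 4 + e / 4) + e / 4); last first.
    by rewrite [in LHS](splitr e) (splitr (e / 2)) -!mulrA -invfM -natrM !addrA.
  by rewrite !ltrD.
pose z := \pi_completion (CauchySeq vcauchy).
apply/cvg_ex; exists z; apply/cvgrPdist_lt => e e0.
have e3 : 0 < e / 4 by rewrite divr_gt0.
have [N HN] := d_small _ e3.
have [N' _ HN'] := completion_pi_cvg (CauchySeq vcauchy) e3.
pose n := maxn N N'.
have dn : d n < e / 4 by apply: HN; exact: leq_maxl.
have zn : `|z - to_completion (v n)| <= e / 4 := HN' n (leq_maxr _ _).
apply: filterS (cF n) => t; rewrite -ball_normE /= => tn.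
have -> : z - t = (z - to_completion (v n)) + (to_completion (v n) - c n) + (c n - t).
  by rewrite !subrKA.
rewrite (le_lt_trans (ler_normD _ _))//.
rewrite (le_lt_trans (lerD (ler_normD _ _) (lexx _)))//.
rewrite [X in _ + X + _]distrC.
rewrite (le_lt_trans (lerD (lerD zn (vc n)) (ltW tn)))//.
rewrite (@lt_le_trans _ _ (e / 4 + e / 4 + e / 4))//.
  by rewrite ltrD// ler_ltD.
rewrite -!mulrDl ler_pdivrMr// -[X in X + X + X]mulr1 -!mulrDr ler_pM2l//.
by rewrite -addrA -[1 + (1 + 1)]/(3%:R) ler_nat.
Qed.

HB.instance Definition _ := Uniform_isComplete.Build completion completion_complete.

End Completion.

Lemma dual_predP (R : realType) (V : normedModType R) (f : V -> R^o) (M : R) :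
  linear f -> (forall v, `|f v| <= M * `|v|) -> f \in dual_pred (V := V).
Proof.
move=> lf fM; apply/asboolP; split=> //.
pose g : {linear V -> R^o} := HB.pack f (GRing.isLinear.Build R V R^o *:%R f lf).
apply: (@bounded_linear_continuous R V R^o g); apply/linear_boundedP; near=> r => v.
by rewrite (le_trans (fM v))// ler_wpM2r//; near: r; apply: nbhs_pinfty_ge; rewrite num_real.
Unshelve. all: by end_near. Qed.

Section Bidual.
Context {R : realType} {V : normedModType R}.

Lemma bidual_eval_subproof (v : V) :
  (fun f : dual V => f v) \in dual_pred (V := dual V).
Proof.
by apply: (@dual_predP _ _ _ `|v|) => // f; rewrite mulrC; exact: dual_norm_bound.
Qed.

Definition bidual_eval (v : V) : dual (dual V) := Dual (bidual_eval_subproof v).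

End Bidual.

Section ClosedSpan.
Context {R : realType} {V : normedModType R} (u : nat -> V).

Definition span_from (n : nat) : set V :=
  [set v | exists (N : nat) (a : nat -> R), v = \sum_(n <= i < N) a i *: u i].

Definition closed_span_pred : {pred V} := fun v => `[< closure (span_from 0) v >].

Lemma span_from_submod (n : nat) :
  span_from n 0 /\ forall (a : R) v w, span_from n v -> span_from n w ->
  span_from n (a *: v + w).
Proof.
have pad (N N' : nat) (b : nat -> R) : (N <= N')%N -> \sum_(n <= i < N) b i *: u i =
    \sum_(n <= i < N') (if (i < N)%N then b i else 0) *: u i.
  move=> NN'; rewrite (big_nat_widen _ _ _ _ _ NN')/= big_mkcond/=.
  by apply: eq_bigr => i _; case: ifP => // _; rewrite scale0r.
split; first by exists n, (fun=> 0); rewrite big_geq.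
move=> a _ _ [N [b ->]] [M [c ->]]; exists (maxn N M).
rewrite (pad _ _ b (leq_maxl N M)) (pad _ _ c (leq_maxr N M)).
exists (fun i => a * (if (i < N)%N then b i else 0) + (if (i < M)%N then c i else 0)).
rewrite scaler_sumr -big_split/=; apply: eq_bigr => i _.
by rewrite scalerDl scalerA.
Qed.

Lemma closed_span_predP v :
  reflect (forall e : R, 0 < e -> exists2 w, span_from 0 w & `|v - w| < e)
          (v \in closed_span_pred).
Proof.
apply: (iffP (asboolP _)) => [cv e e0|cv B /nbhs_normP[e /= e0 eB]].
  have /cv [w [sw vw]] : nbhs v (ball v e) by exact: nbhsx_ballx.
  by exists w => //; move: vw; rewrite -ball_normE.
have [w sw vw] := cv e e0; exists w; split => //; exact: eB.
Qed.

Lemma closed_span_submod_closed : submod_closed closed_span_pred.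
Proof.
have [s0 sP] := span_from_submod 0.
split=> [|a v w /closed_span_predP cv /closed_span_predP cw].
  by apply/closed_span_predP => e e0; exists 0 => //; rewrite subrr normr0.
apply/closed_span_predP => e e0.
have a1 : 0 < `|a| + 1 by rewrite ltr_wpDl.
have e2 : 0 < e / 2 by rewrite divr_gt0.
have [v' sv' vv'] := cv _ (divr_gt0 e2 a1); have [w' sw' ww'] := cw _ e2.
exists (a *: v' + w'); first exact: sP.
rewrite opprD addrACA -scalerBr (le_lt_trans (ler_normD _ _))// [ltRHS]splitr.
rewrite ler_ltD// normrZ (le_trans (ler_wpM2l (normr_ge0 a) (ltW vv')))//.
by rewrite mulrA ler_pdivrMr// mulrC ler_wpM2l ?lerDl// ltW.
Qed.

Record closed_span : Type :=
  ClosedSpan { closed_span_val :> V; closed_spanP : closed_span_val \in closed_span_pred }.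

HB.instance Definition _ := [isSub for closed_span_val].
HB.instance Definition _ := [Choice of closed_span by <:].
HB.instance Definition _ := GRing.SubChoice_isSubLmodule.Build R _ closed_span_pred
  closed_span closed_span_submod_closed.

Definition closed_span_norm (y : closed_span) : R := `|closed_span_val y|.

Lemma closed_span_normD y z :
  closed_span_norm (y + z) <= closed_span_norm y + closed_span_norm z.
Proof. exact: ler_normD. Qed.
Lemma closed_span_normZ a y : closed_span_norm (a *: y) = `|a| * closed_span_norm y.
Proof. exact: normrZ. Qed.
Lemma closed_span_norm0_eq0 y : closed_span_norm y = 0 -> y = 0.
Proof. by move=> /normr0_eq0 y0; exact: val_inj. Qed.

HB.instance Definition _ := Lmodule_isNormed.Build R closed_span
  closed_span_normD closed_span_normZ closed_span_norm0_eq0.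

Lemma closed_span_linear : linear closed_span_val.
Proof. by []. Qed.

Lemma closed_span_normE (y : closed_span) : `|y| = `|closed_span_val y|.
Proof. by []. Qed.

End ClosedSpan.

(* Sequences are indexed from 0. The separability of X is not assumed: it follows
   from [frame_expansion]. *)
Record schauder_frame (R : realType) (X : completeNormedModType R) := SchauderFrame {
  frame_vec : nat -> X;
  frame_fun : nat -> dual X;
  frame_vec_neq0 : forall i, frame_vec i != 0;
  frame_fun_neq0 : forall i, frame_fun i != 0;
  frame_expansion : forall x,
    series (fun i => frame_fun i x *: frame_vec i) @ \oo --> x }.

Section FrameProperties.
Context {R : realType} {X : completeNormedModType R} (F : schauder_frame X).
Local Notation x_ := (frame_vec F).
Local Notation f_ := (frame_fun F).

Definition locally_shrinking := forall m,
  restr_norm (f_ m) (span_from x_ n) @[n --> \oo] --> 0.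

Definition locally_boundedly_complete := forall m,
  restr_norm (bidual_eval (x_ m)) (span_from f_ n) @[n --> \oo] --> 0.

Definition weakly_localized := locally_shrinking /\ locally_boundedly_complete.

Definition pre_boundedly_complete := forall xss : dual (dual X),
  cvgn (series (fun i => xss (f_ i) *: x_ i)).

Definition boundedly_complete_frame := weakly_localized /\ pre_boundedly_complete.

Lemma canonical_map_subproof (x : X) :
  (fun y : closed_span f_ => (closed_span_val y) x)
    \in dual_pred (V := closed_span f_).
Proof.
apply: (@dual_predP _ _ _ `|x|) => [a y z|y].
  by rewrite closed_span_linear dual_addE dual_scaleE.
by rewrite closed_span_normE mulrC; exact: dual_norm_bound.
Qed.

Definition canonical_map (x : X) : dual (closed_span f_) :=
  Dual (canonical_map_subproof x).

End FrameProperties.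

Definition linear_isomorphism (R : realType) (V W : normedModType R) (T : V -> W) :=
  linear T /\ exists S : W -> V,
    [/\ cancel T S, cancel S T, continuous T & continuous S].

(* c_00 is represented by {poly R}, the library's type of eventually vanishing
   sequences: the coordinates of a are a`_i, and e_i is 'X^i. *)
Section MaximalSpace.
Context {R : realType} {X : completeNormedModType R} (F : schauder_frame X).
Local Notation f_ := (frame_fun F).

Definition max_unit_ball : set {poly R} :=
  [set b | forall m n, (m <= n)%N -> `|\sum_(m <= i < n.+1) b`_i *: f_ i| <= 1].

Definition c00_pairing (a b : {poly R}) : R := \sum_(i < size a) a`_i * b`_i.

Definition max_norm (a : {poly R}) : R :=
  sup [set `|c00_pairing a b| | b in max_unit_ball].

Lemma c00_pairingE n (a b : {poly R}) : (size a <= n)%N ->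
  c00_pairing a b = \sum_(i < n) a`_i * b`_i.
Proof.
move=> an; rewrite /c00_pairing (big_ord_widen n (fun i => a`_i * b`_i) an) big_mkcond/=.
by apply: eq_bigr => i _; case: ltnP => // ia; rewrite nth_default// mul0r.
Qed.

Lemma c00_pairingD a a' b : c00_pairing (a + a') b = c00_pairing a b + c00_pairing a' b.
Proof.
rewrite (c00_pairingE (n := maxn (size a) (size a')))// ?size_polyD//.
rewrite (c00_pairingE (a := a) b (leq_maxl _ (size a'))).
rewrite (c00_pairingE (a := a') b (leq_maxr (size a) _)) -big_split/=.
by apply: eq_bigr => i _; rewrite coefD mulrDl.
Qed.

Lemma c00_pairingZ k a b : c00_pairing (k *: a) b = k * c00_pairing a b.
Proof.
rewrite (c00_pairingE b (size_scale_leq k a)) mulr_sumr.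
by apply: eq_bigr => i _; rewrite coefZ mulrA.
Qed.

Lemma max_unit_ball_coef b i : max_unit_ball b -> `|b`_i| <= `|f_ i|^-1.
Proof.
move=> /(_ i i (leqnn i)); rewrite big_nat1 normrZ => bi.
by rewrite -[leRHS]mul1r ler_pdivlMr// normr_gt0 frame_fun_neq0.
Qed.

Lemma max_unit_ball_monomial i : max_unit_ball (`|f_ i|^-1 *: 'X^i).
Proof.
move=> m n _; have f0 := frame_fun_neq0 F i.
under eq_bigr do rewrite coefZ coefXn.
have [imn|imn] := boolP (i \in index_iota m n.+1).
  rewrite (bigD1_seq i)//= ?iota_uniq// big1 ?addr0 => [|j ji].
    by rewrite eqxx mulr1 normrZ normfV normr_id mulVf// normr_eq0.
  by rewrite (negbTE ji) mulr0 scale0r.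
rewrite big_seq big1 ?normr0// => j jmn; case: eqVneq => [ji|]; last first.
  by rewrite mulr0 scale0r.
by move: imn; rewrite -ji jmn.
Qed.

Lemma max_norm_has_sup a : has_sup [set `|c00_pairing a b| | b in max_unit_ball].
Proof.
split; first by exists `|c00_pairing a 0|, 0 => // m n _;
  rewrite big1 ?normr0// => i _; rewrite coef0 scale0r.
exists (\sum_(i < size a) `|a`_i| * `|f_ i|^-1) => _ [b bB <-].
rewrite (le_trans (ler_norm_sum _ _ _))// ler_sum// => i _.
by rewrite normrM ler_wpM2l// max_unit_ball_coef.
Qed.

Lemma max_norm_ub a b : max_unit_ball b -> `|c00_pairing a b| <= max_norm a.
Proof. by move=> bB; apply: (sup_upper_bound (max_norm_has_sup a)); exists b. Qed.

Lemma max_norm_lub a M : (forall b, max_unit_ball b -> `|c00_pairing a b| <= M) ->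
  max_norm a <= M.
Proof.
move=> aM; apply: ge_sup; first exact: (max_norm_has_sup a).1.
by move=> _ [b bB <-]; exact: aM.
Qed.

Definition c00_max : Type := {poly R}.
HB.instance Definition _ := GRing.Lmodule.copy c00_max {poly R}.

Lemma ler_max_normD (a b : c00_max) : max_norm (a + b) <= max_norm a + max_norm b.
Proof.
apply: max_norm_lub => c cB; rewrite c00_pairingD (le_trans (ler_normD _ _))//.
by rewrite lerD// max_norm_ub.
Qed.

Lemma max_normZ k (a : c00_max) : max_norm (k *: a) = `|k| * max_norm a.
Proof.
have leZ l (c : c00_max) : max_norm (l *: c) <= `|l| * max_norm c.
  by apply: max_norm_lub => b bB; rewrite c00_pairingZ normrM ler_wpM2l// max_norm_ub.
apply/le_anti; rewrite leZ/=; have [->|k0] := eqVneq k 0.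
  rewrite normr0 mul0r (le_trans _ (max_norm_ub _ (max_unit_ball_monomial 0)))//.
rewrite -ler_pdivlMl ?normr_gt0//.
by have := leZ k^-1 (k *: a); rewrite scalerA mulVf// scale1r normfV.
Qed.

Lemma max_norm0_eq0 (a : c00_max) : max_norm a = 0 -> a = 0.
Proof.
move=> a0; apply/polyP => i; rewrite coef0; apply/eqP; rewrite -normr_le0.
have := max_norm_ub a (max_unit_ball_monomial i).
rewrite a0 (c00_pairingE (n := maxn (size a) i.+1)) ?leq_maxl//.
have im : (i < maxn (size a) i.+1)%N by rewrite leq_max ltnSn orbT.
rewrite (bigD1 (Ordinal im))//= big1 => [|j ji]; last first.
  by rewrite coefZ coefXn (_ : _ == _ = false) ?mulr0//; exact/negbTE.
rewrite addr0 coefZ coefXn eqxx mulr1 normrM normfV normr_id.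
by rewrite pmulr_lle0// invr_gt0 normr_gt0 frame_fun_neq0.
Qed.

HB.instance Definition _ :=
  Lmodule_isNormed.Build R c00_max ler_max_normD max_normZ max_norm0_eq0.

Lemma c00_max_normE (a : c00_max) : `|a| = max_norm a. Proof. by []. Qed.

Definition Zmax : completeNormedModType R := completion c00_max.

Definition emax (i : nat) : Zmax := to_completion ('X^i : c00_max).

End MaximalSpace.

Section Basis.
Context {R : realType} {Z : completeNormedModType R} (z : nat -> Z).

Definition schauder_basis := forall v : Z,
  exists! a : nat -> R, series (fun i => a i *: z i) @ \oo --> v.

Definition boundedly_complete_basis := schauder_basis /\
  forall a : nat -> R,
    (exists M : R, forall n, `|series (fun i => a i *: z i) n| <= M) ->
    cvgn (series (fun i => a i *: z i)).

End Basis.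

(* Main.v *)
Require Import Defs.
From HB Require Import structures.
From mathcomp Require Import all_boot all_order all_algebra.
From mathcomp Require Import boolp classical_sets functions reals.
From mathcomp Require Import topology normedtype sequences.
From mathcomp Require Import lra.

Import Order.TTheory GRing.Theory Num.Theory.
Import numFieldNormedType.Exports.

Local Open Scope classical_set_scope.
Local Open Scope ring_scope.

(** Write [Y] for the closed span of the [f_ i] in the dual of [X]. All three properties
    amount to the convergence in [X] of [\sum_i y (f_ i) *: x_ i] for every functional [y]
    on [Y].

    By Banach-Steinhaus the partial sums of frame expansions are uniformly bounded. A
    norming functional composed with such a partial sum lies in [Y], so the canonical map
    from [X] to the dual of [Y] is bounded below ([canonical_map_bounded_below]). Local
    shrinking gives [f_ m = \sum_i f_ m (x_ i) *: f_ i] in norm ([frame_fun_expansion]),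
    hence the sum of the series of [y], when it converges, is a preimage of [y]
    ([canonical_map_iso]); conversely the series of the image of [x] is the frame expansion
    of [x]. Functionals on [Y] are the restrictions of functionals on the dual of [X], by
    Hahn-Banach, so convergence for all [y] is pre-bounded completeness.

    A functional [y] on [Y] gives coefficients [y (f_ i)] with bounded partial sums in the
    maximal space, and [e_ i |-> x_ i] is bounded from that space to [X]
    ([emax_dominates]); so if the maximal basis is boundedly complete, the series of [y]
    converges.

    Finally suppose that the canonical map is onto. Norm finitely supported sequences [b] by
    the sums [\sum_(m <= i < n) b`_i *: f_ i]; a sequence [a] with bounded partial sums in
    the maximal space is a bounded functional [phi] for this norm, and it converges if
    [phi] is uniformly small on blocks supported far out ([shrinking]). The sums
    [\sum_i b`_i *: f_ i] of bounded blocks [b] tend weakly to [0], since each functional on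
    [Y] is the evaluation at some [x] and local bounded completeness applies to the finite
    sums approximating [x]. If [phi b >= e] happened for blocks arbitrarily far
    out, a separation argument would provide such blocks whose sums have arbitrarily small
    norm; adding many of them successively keeps the norm bounded while [phi] grows without
    bound. *)

Set Implicit Arguments.
Unset Strict Implicit.

(** * Hahn-Banach with cone constraints *)

Section HahnBanach.
Context {R : realType} {V : lmodType R}.
Implicit Types (p : V -> R) (A : V -> R -> Prop).

Definition sublinear p := (forall x y, p (x + y) <= p x + p y) /\
  (forall (t : R) x, 0 < t -> p (t *: x) <= t * p x).

Definition cone A := [/\ A 0 0,
  (forall v r w s, A v r -> A w s -> A (v + w) (r + s)) &
  (forall (t : R) v r, 0 < t -> A v r -> A (t *: v) (t * r))].

Definition dominated A p := forall v r, A v r -> r <= p v.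

Lemma sublinear0 p : sublinear p -> p 0 = 0.
Proof.
move=> [_ pZ]; have := pZ 2 0 ltac:(lra); have := pZ 2^-1 0 ltac:(lra).
by rewrite !scaler0; lra.
Qed.

Lemma inf_leD (E E1 E2 : set R) : has_lbound E -> E1 !=set0 -> E2 !=set0 ->
  (forall a b, E1 a -> E2 b -> inf E <= a + b) -> inf E <= inf E1 + inf E2.
Proof.
move=> lE E10 E20 H; rewrite -lerBlDr; apply: lb_le_inf => // a Ea.
by rewrite lerBlDr -lerBlDl; apply: lb_le_inf => // b Eb; rewrite lerBlDl; exact: H.
Qed.

Lemma inf_leZ (E E1 : set R) t : 0 < t -> E1 !=set0 ->
  (forall a, E1 a -> inf E <= t * a) -> inf E <= t * inf E1.
Proof.
move=> t0 E10 H; rewrite mulrC -ler_pdivrMr//; apply: lb_le_inf => // a Ea.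
by rewrite ler_pdivrMr// mulrC; exact: H.
Qed.

(** For a cone [A] dominated by [p], this is the largest sublinear minorant of [p] that is
    at most [- r] at [- v] whenever [A v r]; a linear functional below it is thus
    below [p] and at least [r] at [v]. *)
Definition cone_envelope p A (x : V) : R :=
  inf [set e | exists v r, A v r /\ e = p (x + v) - r].

Lemma cone_envelope_lbound p A x : sublinear p -> dominated A p ->
  lbound [set e | exists v r, A v r /\ e = p (x + v) - r] (- p (- x)).
Proof.
move=> [pD _] Ap _ [v [r [Avr ->]]].
by have := pD (x + v) (- x); rewrite addrAC subrr add0r; have := Ap _ _ Avr; lra.
Qed.

Lemma cone_envelope_le p A x v r : sublinear p -> dominated A p -> A v r ->
  cone_envelope p A x <= p (x + v) - r.
Proof.
move=> sp Ap Avr; apply: ge_inf; last by exists v, r.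
by exists (- p (- x)); exact: cone_envelope_lbound.
Qed.

Lemma cone_envelope_sublinear p A : sublinear p -> cone A -> dominated A p ->
  sublinear (cone_envelope p A).
Proof.
move=> sp [A0 AD AZ] Ap.
have ne x : [set e | exists v r, A v r /\ e = p (x + v) - r] !=set0.
  by exists (p (x + 0) - 0), 0, 0.
have [pD pZ] := sp; split=> [x y|t x t0].
  apply: inf_leD => //; first by exists (- p (- (x + y))); exact: cone_envelope_lbound.
  move=> _ _ [v [r [Avr ->]]] [w [s [Aws ->]]].
  apply: le_trans (cone_envelope_le _ sp Ap (AD _ _ _ _ Avr Aws)) _.
  by have := pD (x + v) (y + w); rewrite (addrACA x); lra.
apply: inf_leZ => // _ [v [r [Avr ->]]].
apply: le_trans (cone_envelope_le _ sp Ap (AZ _ _ _ t0 Avr)) _.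
by have := pZ _ (x + v) t0; rewrite scalerDr; lra.
Qed.

(** The sublinear functionals below [p] are bounded below pointwise by [- p (- x)], and the
    infimum of a chain of them is sublinear, so Zorn's lemma applies. *)
Lemma minimal_sublinear p : sublinear p -> exists q, [/\ sublinear q,
  (forall x, q x <= p x) &
  forall q', sublinear q' -> (forall x, q' x <= q x) -> q' = q].
Proof.
move=> sp; pose T := {q | sublinear q /\ forall x, q x <= p x}.
pose le (q q' : T) := `[< forall x, sval q' x <= sval q x >].
have lbd (q : T) x : - p (- x) <= sval q x.
  case: q => q [sq qp] /=; have := qp (- x); have := sq.1 x (- x).
  by rewrite subrr (sublinear0 sq); lra.
have [||||[q [sq qp]] /= qmin] := @Zorn T le.
- by move=> q; apply/asboolP.
- by move=> q1 q2 q3 /asboolP H1 /asboolP H2; apply/asboolP => x; exact: le_trans (H1 x).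
- move=> [q1 s1] [q2 s2] /asboolP H1 /asboolP H2.
  have e : q1 = q2 by apply/funext => x; apply/le_anti; rewrite H1 H2.
  by subst q2; rewrite (Prop_irrelevance s1 s2).
- move=> C Ctot; have [[q0 Cq0]|C0] := pselect (exists q : T, C q); last first.
    by exists (exist _ p (conj sp (fun=> lexx _))) => q Cq; case: C0; exists q.
  pose E x := [set sval q x | q in C].
  have E0 x : E x !=set0 by exists (sval q0 x), q0.
  have El x : has_lbound (E x) by exists (- p (- x)) => _ [q _ <-]; exact: lbd.
  have Ele x q : C q -> inf (E x) <= sval q x by move=> Cq; apply: ge_inf => //; exists q.
  have sE : sublinear (fun x => inf (E x)) /\ forall x, inf (E x) <= p x.
    split; last by move=> x; apply: le_trans (Ele x _ Cq0) _; exact: (svalP q0).2.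
    split=> [x y|t x t0].
      apply: inf_leD => // _ _ [q1 Cq1 <-] [q2 Cq2 <-].
      have [/asboolP le12|/asboolP le21] := Ctot _ _ Cq1 Cq2.
      - apply: le_trans (Ele _ _ Cq2) (le_trans ((svalP q2).1.1 _ _) _).
        by rewrite lerD2r.
      - apply: le_trans (Ele _ _ Cq1) (le_trans ((svalP q1).1.1 _ _) _).
        by rewrite lerD2l.
    apply: inf_leZ => // _ [q1 Cq1 <-].
    exact: le_trans (Ele _ _ Cq1) ((svalP q1).1.2 _ _ t0).
  by exists (exist _ (fun x => inf (E x)) sE) => q Cq; apply/asboolP => x /=; exact: Ele.
exists q; split=> // q' sq' q'q.
have sq'p : sublinear q' /\ forall x, q' x <= p x.
  by split=> // x; exact: le_trans (q'q x) (qp x).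
have /(congr1 sval)// := qmin (exist _ q' sq'p) ltac:(exact/asboolP).
Qed.

(** Minimality of [q] against its envelope by the ray through [(a, q a)] gives
    [q x <= q (x + a) - q a]. *)
Lemma minimal_sublinear_linear q : sublinear q ->
  (forall q', sublinear q' -> (forall x, q' x <= q x) -> q' = q) ->
  linear (q : V -> R^o).
Proof.
move=> sq qmin; have q0 := sublinear0 sq; have [qD qZ] := sq.
have qDE x a : q (x + a) = q x + q a.
  pose A v r := exists t, [/\ 0 <= t, v = t *: a & r = t * q a].
  have cA : cone A.
    split; first by exists 0; rewrite scale0r mul0r.
      move=> _ _ _ _ [s [s0 -> ->]] [t [t0 -> ->]]; exists (s + t).
      by rewrite scalerDl mulrDl addr_ge0.
    move=> t _ _ t0 [s [s0 -> ->]]; exists (t * s).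
    by rewrite scalerA mulrA mulr_ge0// ltW.
  have dA : dominated A q.
    move=> _ _ [t [t0 -> ->]]; move: t0; rewrite le_eqVlt => /predU1P[<-|t0].
      by rewrite scale0r q0 mul0r.
    have := qZ t^-1 (t *: a) ltac:(by rewrite invr_gt0).
    by rewrite scalerA mulVf ?gt_eqF// scale1r mulrC ler_pdivlMr// mulrC.
  have eqq : cone_envelope q A = q.
    apply: qmin; first exact: cone_envelope_sublinear.
    move=> y; have [A0 _ _] := cA.
    by have := cone_envelope_le y sq dA A0; rewrite addr0 subr0.
  have A1 : A a (q a) by exists 1; rewrite scale1r mul1r.
  have := cone_envelope_le x sq dA A1; rewrite eqq => qx.
  by apply/le_anti; rewrite qD/=; lra.
have qN x : q (- x) = - q x by have := qDE x (- x); rewrite subrr q0; lra.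
have qZp t x : 0 < t -> q (t *: x) = t * q x.
  move=> t0; have := qZ _ x t0; have := qZ _ (- x) t0.
  by rewrite scalerN !qN; lra.
move=> t x y; rewrite qDE; congr (_ + _).
have [t0|t0|->] := ltgtP t 0; last by rewrite !scale0r q0.
  by rewrite -[t *: x]opprK -scaleNr qN qZp ?oppr_gt0// mulNr opprK.
exact: qZp.
Qed.

(** Hahn-Banach in the form of Mazur and Orlicz: the constraints [r <= g v] can all be
    met at once as soon as they form a cone and [p] itself meets them. Extension of
    functionals, norming functionals and separation are the choices of cone. *)
Theorem mazur_orlicz p A : sublinear p -> cone A -> dominated A p ->
  exists g : V -> R^o, [/\ linear g, (forall x, g x <= p x) & dominated A g].
Proof.
move=> sp cA dA.
have [q [sq qp qmin]] := minimal_sublinear (cone_envelope_sublinear sp cA dA).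
have lq := minimal_sublinear_linear sq qmin; exists q; split=> // [x|v r Avr].
  apply: le_trans (qp x) _; have [A0 _ _] := cA.
  by have := cone_envelope_le x sp dA A0; rewrite addr0 subr0.
have := le_trans (qp (- v)) (cone_envelope_le (- v) sp dA Avr).
rewrite addNr (sublinear0 sp).
by have := sq.1 v (- v); rewrite subrr (sublinear0 sq); lra.
Qed.

End HahnBanach.

Section DualHahnBanach.
Context {R : realType} {V : normedModType R}.

Lemma mazur_orlicz_dual (c : R) (A : V -> R -> Prop) : 0 <= c -> cone A ->
  dominated A (fun v => c * `|v|) ->
  exists g : dual V, (forall v, `|g v| <= c * `|v|) /\ dominated A g.
Proof.
move=> c0 cA dA; have sp : sublinear (fun v : V => c * `|v|).
  split=> [x y|t x t0]; first by rewrite -mulrDr ler_wpM2l// ler_normD.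
  by rewrite normrZ gtr0_norm// mulrCA.
have [g [lg gp Ag]] := mazur_orlicz sp cA dA.
pose gl : {linear V -> R^o} := HB.pack g (GRing.isLinear.Build R V R^o *:%R g lg).
have gN x : g (- x) = - g x by exact: (linearN gl).
have gb x : `|g x| <= c * `|x|.
  by rewrite ler_norml gp andbT lerNl -gN -[leRHS]/(c * `|x|) -(normrN x) gp.
by exists (Dual (dual_predP lg gb)).
Qed.

(** The constraints form the ray through [(x, `|x|)]. *)
Lemma norming_functional (x : V) :
  exists g : dual V, (forall v, `|g v| <= `|v|) /\ `|x| <= g x.
Proof.
pose A v r := exists t : R, [/\ 0 <= t, v = t *: x & r = t * `|x|].
have [|||g [gb Ag]] := @mazur_orlicz_dual 1 A => //.
- split; first by exists 0; rewrite scale0r mul0r.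
    move=> _ _ _ _ [s [s0 -> ->]] [t [t0 -> ->]]; exists (s + t).
    by rewrite scalerDl mulrDl addr_ge0.
  move=> t _ _ t0 [s [s0 -> ->]]; exists (t * s).
  by rewrite scalerA mulrA mulr_ge0// ltW.
- by move=> _ _ [t [t0 -> ->]]; rewrite mul1r normrZ ger0_norm.
exists g; split; first by move=> v; rewrite -[leRHS]mul1r.
by apply: Ag; exists 1; rewrite scale1r mul1r.
Qed.

(** The constraints form the cone generated by [C * {d}]. *)
Lemma convex_separation (C : set V) (d : R) :
  (forall u v s t, 0 <= s -> 0 <= t -> s + t = 1 -> C u -> C v -> C (s *: u + t *: v)) ->
  (forall v, C v -> d <= `|v|) -> 0 <= d ->
  exists g : dual V, forall v, C v -> d <= g v.
Proof.
move=> Cconv Cd d0.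
pose A v r := exists t u, [/\ 0 <= t, (t = 0 \/ C u), v = t *: u & r = t * d].
have [|||g [_ Ag]] := @mazur_orlicz_dual 1 A => //.
- split; first by exists 0, 0; rewrite scale0r mul0r; split=> //; left.
    move=> _ _ _ _ [s [u [s0 Cu -> ->]]] [t [v [t0 Cv -> ->]]].
    have [s00|sN0] := eqVneq s 0.
      by exists t, v; rewrite s00 scale0r !add0r mul0r add0r.
    have [t00|tN0] := eqVneq t 0.
      by exists s, u; rewrite t00 scale0r !addr0 mul0r addr0.
    have sp : 0 < s by rewrite lt_def sN0.
    have st0 : 0 < s + t by rewrite ltr_pwDl.
    exists (s + t), ((s / (s + t)) *: u + (t / (s + t)) *: v); split.
    + exact: ltW.
    + right; apply: Cconv; rewrite ?divr_ge0 ?(ltW st0)//.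
      * by rewrite -mulrDl divff// gt_eqF.
      * by case: Cu => // s00; rewrite s00 eqxx in sN0.
      * by case: Cv => // t00; rewrite t00 eqxx in tN0.
    + by rewrite scalerDr !scalerA !(mulrC (s + t)) !divfK// gt_eqF.
    + by rewrite mulrDl.
  move=> t _ _ t0 [s [u [s0 Cu -> ->]]]; exists (t * s), u; rewrite scalerA mulrA; split=> //.
    by rewrite mulr_ge0// ltW.
  by case: Cu => [->|]; [left; rewrite mulr0|right].
- move=> _ _ [t [u [t0 [->|Cu] -> ->]]]; first by rewrite mul0r mul1r.
  by rewrite mul1r normrZ ger0_norm// ler_wpM2l// Cd.
by exists g => v Cv; apply: Ag; exists 1, v; rewrite scale1r mul1r; split=> //; right.
Qed.

End DualHahnBanach.

(** * Functionals on closed spans *)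

Lemma linear_bounded_continuous (R : realType) (V W : normedModType R) (T : V -> W) (M : R) :
  linear T -> (forall v, `|T v| <= M * `|v|) -> continuous T.
Proof.
move=> lT TM.
pose g : {linear V -> W} := HB.pack T (GRing.isLinear.Build R V W *:%R T lT).
apply: (@bounded_linear_continuous R V W g); apply/linear_boundedP; near=> r => v.
by rewrite (le_trans (TM v))// ler_wpM2r//; near: r; apply: nbhs_pinfty_ge; rewrite num_real.
Unshelve. all: by end_near. Qed.

Lemma norm_lim_le (R : realType) (V : normedModType R) (u : nat -> V) l (M : R) : u @ \oo --> l ->
  (\forall n \near \oo, `|u n| <= M) -> `|l| <= M.
Proof. by move=> /cvg_norm ul uM; apply: (ler_cvg_to ul (@cvg_cst R M _ \oo _)). Qed.

Section DualCalculus.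
Context {R : realType} {V : normedModType R}.

Lemma dual_subE (g h : dual V) v : (g - h) v = g v - h v.
Proof. by []. Qed.

Lemma dual_linearB (g : dual V) v w : g (v - w) = g v - g w.
Proof. exact: linearB. Qed.

Lemma dual_sumE (a : nat -> R) (g : nat -> dual V) m n v :
  (\sum_(m <= i < n) a i *: g i) v = \sum_(m <= i < n) a i * g i v.
Proof. by elim/big_ind2: _ => // h s h' s' <- <-. Qed.

Lemma dual_cvg_sum (g : dual V) (a : nat -> R) (v : nat -> V) l :
  series (fun i => a i *: v i) @ \oo --> l ->
  series (fun i => a i * g (v i) : R^o) @ \oo --> g l.
Proof.
move=> al; have := cvg_comp _ _ al (@dual_continuous _ _ g l); apply: cvg_trans.
rewrite (_ : _ \o _ = series (fun i => a i * g (v i) : R^o)) //.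
by apply/funext => n /=; rewrite /series/= linear_sum; apply: eq_bigr => i _; rewrite linearZ.
Qed.

End DualCalculus.

Arguments dual_cvg_sum {R V} g {a v l} _.

Section ClosedSpanElements.
Context {R : realType} {V : normedModType R} (u : nat -> V).

Lemma mem_closed_span v : span_from u 0 v -> v \in closed_span_pred u.
Proof. by move=> uv; apply/closed_span_predP => e e0; exists v => //; rewrite subrr normr0. Qed.

Lemma span_from_sum (a : nat -> R) m n : span_from u m (\sum_(m <= i < n) a i *: u i).
Proof. by exists n, a. Qed.

Lemma span_from_gen i : span_from u 0 (u i).
Proof.
exists i.+1, (fun k => (k == i)%:R); rewrite big_nat_recr//= eqxx scale1r.
rewrite big_nat_cond big1 ?add0r//.
by move=> k /andP[/andP[_ ki] _]; rewrite (ltn_eqF ki) scale0r.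
Qed.

Lemma span_fromZ n (a : R) v : span_from u n v -> span_from u n (a *: v).
Proof. by have [s0 sP] := span_from_submod u n => uv; rewrite -[_ *: _]addr0; exact: sP. Qed.

Lemma restr_norm_span (g : dual V) n v : span_from u n v ->
  `|g v| <= restr_norm g (span_from u n) * `|v|.
Proof.
move=> uv; apply: restr_normP => //; first exact: (span_from_submod u n).1.
by move=> a; exact: span_fromZ.
Qed.

Lemma restr_norm_span_ge0 (g : dual V) n : 0 <= restr_norm g (span_from u n).
Proof.
have s0 := (span_from_submod u n).1.
apply: (sup_upper_bound (restr_norm_has_sup g s0)).
by exists 0; [split=> //=; rewrite normr0|rewrite linear0 normr0].
Qed.

Definition closed_span_gen (i : nat) : closed_span u :=
  ClosedSpan (mem_closed_span (span_from_gen i)).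

Lemma closed_span_val_sum (a : nat -> R) n :
  closed_span_val (\sum_(0 <= i < n) a i *: closed_span_gen i) = \sum_(0 <= i < n) a i *: u i.
Proof. by elim/big_ind2: _ => // x x' y y' <- <-. Qed.

Lemma closed_span_dual_eq (g h : dual (closed_span u)) :
  (forall i, g (closed_span_gen i) = h (closed_span_gen i)) -> g = h.
Proof.
move=> gh; apply/val_inj/funext => y; apply/eqP; rewrite -subr_eq0 -normr_le0.
rewrite -[g y - h y]/((g - h) y).
apply/ler_addgt0Pl => e e0; rewrite addr0.
have K1 : 0 < `|g - h| + 1 by rewrite ltr_wpDl.
have /closed_span_predP/(_ _ (divr_gt0 e0 K1))[_ [n [a ->]] yw] := closed_spanP y.
pose w := \sum_(0 <= i < n) a i *: closed_span_gen i.
have w0 : (g - h) w = 0.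
  rewrite linear_sum big1// => i _; rewrite linearZ/= -[X in _ *: X]/(g _ - h _).
  by rewrite gh subrr scaler0.
have -> : (g - h) y = (g - h) (y - w).
  by rewrite [RHS](dual_linearB (g - h)) w0 subr0.
apply: le_trans (dual_norm_bound _ _) _.
rewrite closed_span_normE -[closed_span_val (y - w)]/(closed_span_val y - closed_span_val w).
rewrite closed_span_val_sum (le_trans (ler_wpM2l (dual_norm_ge0 _) (ltW yw)))//.
by rewrite mulrC -mulrA ler_piMr// ?ltW// ltr_pdivrMl// mulr1 ltrDl.
Qed.

Lemma closed_span_dual_restrict (g : dual V) :
  exists y : dual (closed_span u), forall z, y z = g (closed_span_val z).
Proof.
have gP : (fun z : closed_span u => g (closed_span_val z)) \in
    dual_pred (V := closed_span u).
  apply: (@dual_predP _ _ _ (dual_norm g)) => [a z z'|z].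
    by rewrite closed_span_linear linearP.
  exact: dual_norm_bound.
by exists (Dual gP).
Qed.

Lemma closed_span_dual_extend (y : dual (closed_span u)) :
  exists g : dual V, forall z, g (closed_span_val z) = y z.
Proof.
pose A v r := exists z : closed_span u, v = closed_span_val z /\ r = y z.
(* the graph of [y] is a cone lying below the norm scaled by [dual_norm y] *)
have [||g [_ Ag]] := @mazur_orlicz_dual _ _ (dual_norm y) A (dual_norm_ge0 y).
- split; first by exists 0; rewrite linear0.
    move=> _ _ _ _ [z [-> ->]] [z' [-> ->]]; exists (z + z').
    by rewrite (linearD y).
  by move=> t _ _ _ [z [-> ->]]; exists (t *: z); rewrite linearZ.
- move=> _ _ [z [-> ->]]; exact: le_trans (ler_norm _) (dual_norm_bound y z).
exists g => z; apply/le_anti/andP; split; last by apply: Ag; exists z.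
have : y (- z) <= g (closed_span_val (- z)) by apply: Ag; exists (- z).
by rewrite (linearN y) -[closed_span_val (- z)]/(- closed_span_val z) (linearN g) lerN2.
Qed.

End ClosedSpanElements.

(** * Frame expansions in the predual *)

Section FrameTheory.
Context {R : realType} {X : completeNormedModType R} (F : schauder_frame X).
Local Notation x_ := (frame_vec F).
Local Notation f_ := (frame_fun F).

Lemma partial_sum_linear n : linear (fun x => \sum_(0 <= i < n) f_ i x *: x_ i).
Proof.
move=> a x y; rewrite scaler_sumr -big_split/=; apply: eq_bigr => i _.
by rewrite linearP scalerDl scalerA.
Qed.

(** The partial sum operators converge pointwise, so they are uniformly bounded. *)
Lemma frame_bounded : exists2 K : R, 0 <= K &
  forall m n x, `|\sum_(m <= i < n) f_ i x *: x_ i| <= K * `|x|.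
Proof.
pose S n x := \sum_(0 <= i < n) f_ i x *: x_ i.
have Sb n : exists2 M, 0 <= M & forall x, `|S n x| <= M * `|x|.
  exists (\sum_(0 <= i < n) dual_norm (f_ i) * `|x_ i|).
    by apply: sumr_ge0 => i _; rewrite mulr_ge0// dual_norm_ge0.
  move=> x; rewrite (le_trans (ler_norm_sum _ _ _))// mulr_suml ler_sum// => i _.
  by rewrite normrZ mulrAC ler_wpM2r// dual_norm_bound.
have /(_ 1)[M SM] : uniform_bounded [set S n | n in setT].
  apply: Banach_Steinhauss => [_ [n _ <-]|x].
    split; last exact: partial_sum_linear.
    have [M M0 SM] := Sb n => r; exists (M * r) => x xr.
    by rewrite (le_trans (SM x))// ler_wpM2l.
  have /cvg_seq_bounded/ex_strict_bound_gt0[M M0 SM] : cvgn (fun n => S n x).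
    by apply/cvg_ex; exists x; exact: frame_expansion.
  by exists M => _ [n _ <-]; apply/ltW/SM.
have M0 : 0 <= M.
  by apply: le_trans (SM _ (ex_intro2 _ _ 0%N I erefl) 0 _); rewrite ?normr0.
have SMx n x : `|S n x| <= M * `|x|.
  have [->|x0] := eqVneq x 0.
    by rewrite /S big1 ?normr0 ?mulr0// => i _; rewrite linear0 scale0r.
  have := SM _ (ex_intro2 _ _ n I erefl) (`|x|^-1 *: x).
  rewrite normrZ normfV normr_id mulVf ?normr_eq0// => /(_ (lexx _)).
  have -> : S n (`|x|^-1 *: x) = `|x|^-1 *: S n x.
    by rewrite /S scaler_sumr; apply: eq_bigr => i _; rewrite linearZ scalerA.
  by rewrite normrZ normfV normr_id ler_pdivrMl ?normr_gt0// mulrC.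
exists (M + M) => [|m n x]; first exact: addr_ge0.
have [mn|/ltnW nm] := leqP m n; last by rewrite big_geq// normr0 mulr_ge0// addr_ge0.
have -> : \sum_(m <= i < n) f_ i x *: x_ i = S n x - S m x.
  by rewrite /S (big_cat_nat (leq0n m) mn)//= addrAC subrr add0r.
by rewrite mulrDl (le_trans (ler_normB _ _))// lerD.
Qed.

Lemma frame_tail_le K n x (g : dual X) : 0 <= K ->
  (forall m n x, `|\sum_(m <= i < n) f_ i x *: x_ i| <= K * `|x|) ->
  `|g (x - \sum_(0 <= i < n) f_ i x *: x_ i)| <= restr_norm g (span_from x_ n) * (K * `|x|).
Proof.
move=> K0 SK; set S := \sum_(0 <= _ < _) _.
have : (fun N => g (series (fun i => f_ i x *: x_ i) N - S)) @ \oo --> g (x - S).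
  have xS : (fun N => series (fun i => f_ i x *: x_ i) N - S) @ \oo --> x - S.
    by apply: cvgB (cvg_cst _); exact: frame_expansion.
  exact: cvg_comp _ _ xS (@dual_continuous _ _ g _).
move=> /norm_lim_le; apply; exists n => // N /= nN.
rewrite /series/= (big_cat_nat (leq0n n) nN)//= addrAC subrr add0r.
apply: le_trans (restr_norm_span _ (span_from_sum _ _ _ _)) _.
by rewrite ler_wpM2l// restr_norm_span_ge0.
Qed.

(** The remainder of this series is the adjoint of the tail operator
    [x |-> x - \sum_(0 <= i < n) f_ i x *: x_ i] applied to [f_ m], and local shrinking
    makes [f_ m] uniformly small on such tails. *)
Lemma frame_fun_expansion : locally_shrinking F -> forall m : nat,
  series (fun i => f_ m (x_ i) *: f_ i) @ \oo --> f_ m.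
Proof.
move=> shr m; have /cvgrPdist_le fm := shr m; have [K K0 SK] := frame_bounded.
apply/cvgrPdist_le => e e0; have K1 : 0 < K + 1 by rewrite ltr_wpDl.
have [N _ NP] := fm _ (divr_gt0 e0 K1); exists N => // n /= Nn.
apply: restr_norm_le => // [|x _]; first exact: ltW.
have -> : (f_ m - series (fun i => f_ m (x_ i) *: f_ i) n) x =
    f_ m (x - \sum_(0 <= i < n) f_ i x *: x_ i).
  rewrite [RHS]linearB dual_subE; congr (_ - _).
  rewrite /series/= dual_sumE [RHS]linear_sum; apply: eq_bigr => i _.
  by rewrite [RHS]linearZ mulrC.
apply: le_trans (frame_tail_le n x (f_ m) K0 SK) _; rewrite mulrA ler_wpM2r//.
have := NP n Nn; rewrite /= sub0r normrN => /(le_trans (ler_norm _)) rn.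
by apply: le_trans (ler_wpM2r K0 rn) _; rewrite mulrAC ler_pdivrMr// ler_wpM2l ?lerDl// ltW.
Qed.

(** The adjoint partial sums [h] of a functional [g] norming [x] lie in the span of the
    [f_ i] and are bounded by the frame constant, while [h x] tends to [g x = `|x|]. *)
Lemma canonical_map_bounded_below : exists2 K : R, 0 <= K &
  forall x, `|x| <= K * `|canonical_map F x|.
Proof.
have [K K0 SK] := frame_bounded; exists K => // x.
have [g [gb gx]] := norming_functional x; apply: le_trans gx _.
apply: le_trans (ler_norm _) _.
have /norm_lim_le := dual_cvg_sum g (@frame_expansion _ _ F x); apply.
apply: nearW => n; pose h := \sum_(0 <= i < n) g (x_ i) *: f_ i.
have hx y : h y = g (\sum_(0 <= i < n) f_ i y *: x_ i).
  by rewrite dual_sumE [RHS]linear_sum; apply: eq_bigr => i _; rewrite [RHS]linearZ mulrC.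
have hK : `|h| <= K.
  by apply: restr_norm_le => // y _; rewrite hx (le_trans (gb _)).
pose y : closed_span f_ := \sum_(0 <= i < n) g (x_ i) *: closed_span_gen f_ i.
have yh : closed_span_val y = h by exact: closed_span_val_sum.
have -> : series (fun i => f_ i x * g (x_ i) : R^o) n = canonical_map F x y.
  rewrite -[RHS]/(closed_span_val y x) yh hx linear_sum /series/=.
  by apply: eq_bigr => i _; rewrite linearZ.
rewrite mulrC (le_trans (dual_norm_bound _ _))// ler_wpM2l// ?dual_norm_ge0//.
by rewrite closed_span_normE yh.
Qed.

Lemma canonical_map_linear : linear (canonical_map F).
Proof.
by move=> a x y; apply/val_inj/funext => h; rewrite /= -[RHS]/(_ * _ + _) linearP.
Qed.

Lemma canonical_map_le x : `|canonical_map F x| <= 1 * `|x|.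
Proof.
apply: restr_norm_le; rewrite ?mul1r// => y _.
by rewrite -[canonical_map F x y]/(closed_span_val y x) mulrC; exact: dual_norm_bound.
Qed.

(** The sum [x] of the series of [y] represents [y]: by continuity of [f_ m] and of [y],
    [f_ m x] and [y (f_ m)] are both the sum of the [y (f_ i) * f_ m (x_ i)], the second
    one because [f_ m] is the sum of the [f_ m (x_ i) *: f_ i]. *)
Lemma canonical_map_iso : locally_shrinking F ->
  (forall y : dual (closed_span f_),
    cvgn (series (fun i => y (closed_span_gen f_ i) *: x_ i))) ->
  linear_isomorphism (canonical_map F).
Proof.
move=> shr ycvg; split; first exact: canonical_map_linear.
have [K K0 Jb] := canonical_map_bounded_below.
have /choice[S JS] (y : dual (closed_span f_)) : exists x, canonical_map F x = y.
  have /cvg_ex[x yx] := ycvg y; exists x; apply: closed_span_dual_eq => m.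
  have fm : series (fun i => f_ m (x_ i) *: closed_span_gen f_ i) @ \oo -->
      closed_span_gen f_ m.
    apply/cvgrPdist_le => e e0; have /cvgrPdist_le/(_ e e0) := @frame_fun_expansion shr m.
    apply: filterS => n; rewrite closed_span_normE => ne.
    rewrite -[closed_span_val _]/(f_ m - closed_span_val _).
    by rewrite closed_span_val_sum.
  have l1 := dual_cvg_sum (f_ m) yx; have l2 := dual_cvg_sum y fm.
  suff e : (fun i => y (closed_span_gen f_ i) * f_ m (x_ i) : R^o) =
      fun i => f_ m (x_ i) * y (closed_span_gen f_ i).
    by apply: (cvg_unique _ l1) => /=; [exact: norm_hausdorff|rewrite e].
  by apply/funext => i; rewrite mulrC.
pose Jl : {linear X -> dual (closed_span f_)} :=
  HB.pack (canonical_map F) (GRing.isLinear.Build R X _ *:%R _ canonical_map_linear).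
have Jinj : injective (canonical_map F).
  move=> x x' xx'; apply/eqP; rewrite -subr_eq0 -normr_le0 (le_trans (Jb _))//.
  have -> : canonical_map F (x - x') = canonical_map F x - canonical_map F x'.
    exact: (linearB Jl).
  by rewrite xx' subrr normr0 mulr0.
exists S; split=> // [z||].
- by apply: Jinj; rewrite JS.
- exact: linear_bounded_continuous canonical_map_linear canonical_map_le.
- apply: (@linear_bounded_continuous _ _ _ _ K) => [a y z|y].
    by apply: Jinj; rewrite canonical_map_linear !JS.
  by rewrite -{2}(JS y).
Qed.

End FrameTheory.

(** * Weakly null blocks and shrinking *)

Section Shrinking.
Context {R : realType}.

Definition lincomb (W : lmodType R) (u : nat -> W) (p : {poly R}) : W :=
  \sum_(0 <= i < size p) p`_i *: u i.

Lemma lincombE (W : lmodType R) (u : nat -> W) (p : {poly R}) n : (size p <= n)%N ->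
  lincomb u p = \sum_(0 <= i < n) p`_i *: u i.
Proof.
move=> pn; rewrite /lincomb (big_cat_nat (leq0n _) pn)/= [X in _ = _ + X]big_nat.
rewrite [X in _ = _ + X]big1 ?addr0// => i /andP[pi _].
by rewrite nth_default// scale0r.
Qed.

Lemma lincombD (W : lmodType R) (u : nat -> W) (p q : {poly R}) :
  lincomb u (p + q) = lincomb u p + lincomb u q.
Proof.
pose n := maxn (size p) (size q).
rewrite (@lincombE _ u p n) ?leq_maxl// (@lincombE _ u q n) ?leq_maxr//.
rewrite (@lincombE _ u (p + q) n) ?size_polyD// -big_split/=.
by apply: eq_bigr => i _; rewrite coefD scalerDl.
Qed.

Lemma lincombZ (W : lmodType R) (u : nat -> W) t (p : {poly R}) :
  lincomb u (t *: p) = t *: lincomb u p.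
Proof.
rewrite (lincombE u (size_scale_leq t p)) scaler_sumr.
by apply: eq_bigr => i _; rewrite coefZ scalerA.
Qed.

Definition supported_from n (p : {poly R}) := forall i, (i < n)%N -> p`_i = 0.

Context {V : normedModType R} (u : nat -> V).

Definition prefixes_le (r : R) (p : {poly R}) :=
  forall n, `|\sum_(0 <= i < n) p`_i *: u i| <= r.

Lemma prefixes_leD r s (p q : {poly R}) :
  prefixes_le r p -> prefixes_le s q -> prefixes_le (r + s) (p + q).
Proof.
move=> pr qs n; under eq_bigr do rewrite coefD scalerDl.
by rewrite big_split/= (le_trans (ler_normD _ _))// lerD.
Qed.

Lemma prefixes_leZ r t (p : {poly R}) : 0 <= t ->
  prefixes_le r p -> prefixes_le (t * r) (t *: p).
Proof.
move=> t0 pr n; under eq_bigr do rewrite coefZ -scalerA.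
by rewrite -scaler_sumr normrZ ger0_norm// ler_wpM2l.
Qed.

(** Summing [N] successive blocks on which [phi] is at least [e], but whose images
    in [V] have norm less than [d], the partial sums only grow by [d] per
    block: each one ends within a single block. *)
Lemma block_sums (phi : nat -> R^o) (e d : R) :
  (forall n, exists p, [/\ supported_from n p, prefixes_le 1 p,
     e <= lincomb phi p & `|lincomb u p| < d]) ->
  0 <= d -> forall N n, exists p, [/\ supported_from n p,
     prefixes_le (1 + N%:R * d) p & N%:R * e <= lincomb phi p].
Proof.
move=> blk d0; elim=> [|N IH] n.
  exists 0; split=> [i _||]; rewrite ?coef0// ?mul0r.
    by move=> k; rewrite big1 ?normr0 ?addr0// => i _; rewrite coef0 scale0r.
  by rewrite /lincomb size_poly0 big_geq.
have [p [sp pp ep dp]] := blk n.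
have [q [sq qq eq]] := IH (maxn n (size p)).
exists (p + q); split=> [i ni|k|]; last by rewrite lincombD -natr1; lra.
  by rewrite coefD sp// sq ?addr0// leq_max ni.
under eq_bigr do rewrite coefD scalerDl; rewrite big_split/=.
have [kp|/ltnW pk] := leqP k (size p).
  rewrite [X in _ + X]big_nat [X in _ + X]big1 ?addr0 => [|i /andP[_ ik]].
    by apply: le_trans (pp k) _; rewrite lerDl mulr_ge0.
  by rewrite sq ?scale0r// leq_max (leq_trans ik kp) orbT.
rewrite -(lincombE u pk) (le_trans (ler_normD _ _))//.
by have := qq k; rewrite -natr1; lra.
Qed.

(** If bounded blocks far out are weakly null, then a bounded functional is small on
    blocks far out. Otherwise the images in [V] of the blocks on which [phi] is at least
    [e] form a convex set, having [0] in its closure since it cannot be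
    separated from [0]; summing such blocks contradicts boundedness. *)
Lemma shrinking (phi : nat -> R^o) (M : R) :
  (forall (g : dual V) d, 0 < d -> exists n, forall p,
     supported_from n p -> prefixes_le 1 p -> g (lincomb u p) < d) ->
  (forall p r, 0 < r -> prefixes_le r p -> lincomb phi p <= M * r) ->
  forall e, 0 < e -> exists n, forall p,
    supported_from n p -> prefixes_le 1 p -> lincomb phi p <= e.
Proof.
move=> wnull phiM e e0; apply: contrapT => far.
pose C n p := [/\ supported_from n p, prefixes_le 1 p & e <= lincomb phi p].
have C0 n : exists p, C n p.
  apply: contrapT => nC; apply: far; exists n => p sp pp.
  by rewrite leNgt; apply/negP => ep; apply: nC; exists p; split=> //; exact: ltW.
have small n d : 0 < d -> exists2 p, C n p & `|lincomb u p| < d.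
  move=> d0; apply: contrapT => ns.
  have [|||g gd] := @convex_separation _ _ (lincomb u @` C n) d.
  - move=> _ _ s t s0 t0 st [p [sp pp ep] <-] [q [sq pq eq] <-].
    exists (s *: p + t *: q); last by rewrite lincombD !lincombZ.
    split=> [i ni||].
    + by rewrite coefD !coefZ sp// sq// !mulr0 addr0.
    + by rewrite -st -[s in s + t]mulr1 -[t in _ + t]mulr1;
        apply: prefixes_leD; exact: prefixes_leZ.
    + rewrite lincombD !lincombZ -[e]mul1r -st mulrDl.
      by rewrite lerD// -[_ *: _]/(_ * _) ler_wpM2l.
  - move=> _ [p Cp <-]; rewrite leNgt; apply/negP => pd.
    by apply: ns; exists p.
  - exact: ltW.
  have [n' gn'] := wnull g d d0; have [p [sp pp ep]] := C0 (maxn n n').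
  have : g (lincomb u p) < d by apply: gn' => // i ni; rewrite sp// leq_max ni orbT.
  rewrite ltNge => /negP; apply; apply: gd; exists p => //; split=> // i ni.
  by rewrite sp// leq_max ni.
pose N := (Num.bound (`|2 * M| / e)).+1.
have N0 : 0 < N%:R :> R by rewrite ltr0n.
have NM : 2 * M < N%:R * e.
  rewrite -ltr_pdivrMr//; apply: (@le_lt_trans _ _ (`|2 * M| / e)).
    by rewrite ler_pM2r ?invr_gt0// ler_norm.
  apply: (@lt_le_trans _ _ (Num.bound (`|2 * M| / e))%:R); last by rewrite ler_nat.
  by rewrite archi_boundP// divr_ge0// ltW.
have N0' : 0 < N%:R^-1 :> R by rewrite invr_gt0.
have [||p [_ pp pe]] := @block_sums phi e N%:R^-1 _ _ N 0%N.
- by move=> n; have [p [sp pp ep] pd] := small n _ N0'; exists p.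
- exact: ltW.
have p2 : prefixes_le 2 p by move: pp; rewrite divff ?gt_eqF.
by have := phiM p 2 ltac:(lra) p2; lra.
Qed.

End Shrinking.

(** * The maximal basis *)

Section MaximalBasis.
Context {R : realType} {X : completeNormedModType R} (F : schauder_frame X).
Local Notation x_ := (frame_vec F).
Local Notation f_ := (frame_fun F).
Local Notation e_ := (emax F).

(** The norm carried by [c00_max] depends on the frame, which its type does not show;
    the codomain [Zmax F] fixes it. *)
Definition to_Zmax (p : {poly R}) : Zmax F := to_completion (p : c00_max).

Lemma to_Zmax_linear : linear to_Zmax.
Proof. by move=> a p q; exact: to_completion_linear. Qed.

HB.instance Definition _ :=
  GRing.isLinear.Build R {poly R} (Zmax F) *:%R to_Zmax to_Zmax_linear.

Lemma to_Zmax_norm p : `|to_Zmax p| = max_norm F p.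
Proof. exact: to_completion_norm. Qed.

Lemma to_Zmax_dense (v : Zmax F) e : 0 < e -> exists p, `|v - to_Zmax p| <= e.
Proof. by move=> e0; have [p vp] := to_completion_dense v e0; exists p. Qed.

Lemma emax_sumE (a : nat -> R) m n :
  \sum_(m <= i < n) a i *: e_ i = to_Zmax (\sum_(m <= i < n) a i *: 'X^i).
Proof.
by rewrite linear_sum; apply: eq_bigr => i _; rewrite linearZ.
Qed.

Lemma emax_poly (p : {poly R}) n : (size p <= n)%N -> \sum_(0 <= i < n) p`_i *: e_ i = to_Zmax p.
Proof.
move=> pn; rewrite emax_sumE big_mkord -poly_def.
congr to_Zmax; apply/polyP => i; rewrite coef_poly.
by case: ltnP => // ni; rewrite nth_default// (leq_trans pn).
Qed.

Lemma c00_pairing_sum (a : nat -> R) m n b :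
  c00_pairing (\sum_(m <= i < n) a i *: 'X^i) b = \sum_(m <= i < n) a i * b`_i.
Proof.
have pX i : c00_pairing 'X^i b = b`_i.
  rewrite (c00_pairingE (n := i.+1)) ?size_polyXn// big_ord_recr/= coefXn eqxx mul1r.
  by rewrite big1 ?add0r// => j _; rewrite coefXn ltn_eqF ?ltn_ord// mul0r.
elim/big_ind2: _ => [|p s q t <- <-|i _].
- by rewrite /c00_pairing size_poly0 big_ord0.
- by rewrite c00_pairingD.
- by rewrite c00_pairingZ pX.
Qed.

Lemma emax_norm_ge (a : nat -> R) m n b : max_unit_ball F b ->
  `|\sum_(m <= i < n) a i * b`_i| <= `|\sum_(m <= i < n) a i *: e_ i|.
Proof.
move=> bB; rewrite -c00_pairing_sum emax_sumE to_Zmax_norm.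
exact: max_norm_ub.
Qed.

Lemma emax_norm_le (a : nat -> R) m n M :
  (forall b, max_unit_ball F b -> `|\sum_(m <= i < n) a i * b`_i| <= M) ->
  `|\sum_(m <= i < n) a i *: e_ i| <= M.
Proof.
move=> aM; rewrite emax_sumE to_Zmax_norm; apply: max_norm_lub => b /aM.
by rewrite -c00_pairing_sum.
Qed.

Definition truncate m n (b : nat -> R) : {poly R} :=
  \poly_(i < n) (if (m <= i)%N then b i else 0).

Lemma truncateE m n b i : (truncate m n b)`_i = if (m <= i < n)%N then b i else 0.
Proof. by rewrite coef_poly andbC; case: (i < n)%N. Qed.

Lemma truncate_sum (W : lmodType R) (u : nat -> W) m n b k l :
  \sum_(k <= i < l) (truncate m n b)`_i *: u i =
  \sum_(maxn k m <= i < minn l n) b i *: u i.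
Proof.
rewrite [RHS](big_nat_widenl _ k) ?leq_maxl// [RHS](big_nat_widen _ _ l) ?geq_minl//.
rewrite [LHS]big_nat_cond [RHS]big_nat_cond [LHS]big_mkcond [RHS]big_mkcond/=.
apply: eq_bigr => i _; rewrite truncateE geq_max leq_min.
case: (k <= i)%N; case: (i < l)%N; case: (m <= i)%N; case: (i < n)%N => //=;
  by rewrite scale0r.
Qed.

Lemma truncate_ball m n (b : nat -> R) :
  (forall k l, `|\sum_(k <= i < l) b i *: f_ i| <= 1) ->
  max_unit_ball F (truncate m n b).
Proof. by move=> b1 k l _; rewrite truncate_sum. Qed.

Lemma max_unit_ball_sum b k l : max_unit_ball F b ->
  `|\sum_(k <= i < l) b`_i *: f_ i| <= 1.
Proof.
move=> bB; case: l => [|l]; first by rewrite big_geq// normr0.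
have [kl|lk] := leqP k l; first exact: bB.
by rewrite big_geq// normr0.
Qed.

(** Truncation preserves the unit ball, so the basis projections are contractions. *)
Lemma emax_proj_le (a : nat -> R) m n :
  (m <= n)%N -> `|\sum_(0 <= i < m) a i *: e_ i| <= `|\sum_(0 <= i < n) a i *: e_ i|.
Proof.
move=> mn; apply: emax_norm_le => b bB.
have bT : max_unit_ball F (truncate 0 m (fun i => b`_i)).
  by apply: truncate_ball => k l; exact: max_unit_ball_sum.
apply: le_trans (emax_norm_ge a 0 n bT).
rewrite (_ : \sum_(0 <= i < n) _ = \sum_(0 <= i < m) a i * b`_i)//.
have := @truncate_sum R^o a 0 m (fun i => b`_i) 0 n.
rewrite maxnn (minn_idPr mn).
under eq_bigr do rewrite -[_ *: _]/(_ * _) mulrC.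
by under [RHS]eq_bigr do rewrite -[_ *: _]/(_ * _) mulrC.
Qed.

Lemma emax_coef_le (a : nat -> R) i n : (i < n)%N ->
  `|a i| <= `|f_ i| * `|\sum_(0 <= k < n) a k *: e_ k|.
Proof.
move=> i_n; have f0 : 0 < `|f_ i| by rewrite normr_gt0 frame_fun_neq0.
have := emax_norm_ge a 0 n (max_unit_ball_monomial F i).
rewrite (bigD1_seq i) ?mem_index_iota ?iota_uniq//= big1 => [|k ki]; last first.
  by rewrite coefZ coefXn (negbTE ki) !mulr0.
rewrite addr0 coefZ coefXn eqxx mulr1 normrM normfV normr_id.
by rewrite mulrC ler_pdivrMl.
Qed.

Lemma emax_approx (v : Zmax F) : exists w : nat -> {poly R},
  (fun k => to_Zmax (w k)) @ \oo --> v.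
Proof.
have /choice[w vw] (k : nat) : exists p, `|v - to_Zmax p| <= k.+1%:R^-1.
  by apply: to_Zmax_dense; rewrite invr_gt0.
exists w; apply/cvgrPdist_le => e e0; near=> k; apply: le_trans (vw k) _.
rewrite invf_ple ?posrE//; apply: le_trans (_ : k%:R <= _); last by rewrite ler_nat.
by near: k; exact: nbhs_infty_ger.
Unshelve. all: by end_near. Qed.

(** Coordinates are continuous on finitely supported sequences, which are dense; the limits
    [a] of the coordinates give the expansion of [v] because the basis projections are
    contractions. *)
Lemma emax_basis : schauder_basis e_.
Proof.
move=> v; have [w wv] := emax_approx v.
pose c k i := (w k)`_i.
have cB k l i : `|c k i - c l i| <= `|f_ i| * max_norm F (w k - w l).
  pose N := maxn i.+1 (size (w k - w l)).
  have := @emax_coef_le (fun j => (w k - w l)`_j) i N.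
  by rewrite emax_poly ?leq_maxr// to_Zmax_norm coefB; apply; exact: leq_maxl.
have wC e : 0 < e -> exists K, (forall k, (K <= k)%N -> `|v - to_Zmax (w k)| <= e) /\
    forall k l, (K <= k)%N -> (K <= l)%N -> max_norm F (w k - w l) <= e.
  move=> e0; have /cvgrPdist_le/(_ _ (divr_gt0 e0 (ltr0n R 2)))[K _ KP] := wv.
  exists K; split=> [k /KP|k l /KP/= kK /KP/= lK]; first by rewrite /=; lra.
  rewrite -to_Zmax_norm linearB/= -(subrKA v) (le_trans (ler_normD _ _))//.
  by rewrite (splitr e) lerD// distrC.
have /choice[a ca] i : exists ai : R, (fun k => c k i) @ \oo --> ai.
  apply/cvg_ex/(@cauchy_cvgP R)/cauchy_exP => e e0.
  have f1 : 0 < `|f_ i| + 1 by rewrite ltr_wpDl.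
  have [K [_ KP]] := wC _ (divr_gt0 e0 f1).
  exists (c K i), K => // k /= Kk; rewrite /ball/=.
  apply: (le_lt_trans (cB _ _ i)).
  apply: (le_lt_trans (ler_wpM2l (normr_ge0 _) (KP _ _ (leqnn _) Kk))).
  by rewrite mulrCA gtr_pMr// ltr_pdivrMr// mul1r ltrDl.
have av : series (fun i => a i *: e_ i) @ \oo --> v.
  apply/cvgrPdist_le => e e0; have [K [vK KP]] := wC _ (divr_gt0 e0 (ltr0n R 2)).
  pose p := w K; exists (size p) => // n /= pn.
  rewrite -(subrKA (to_Zmax p)) (le_trans (ler_normD _ _))//.
  rewrite [leRHS]splitr; apply: lerD; first exact: vK.
  rewrite -(emax_poly pn) /series/= -sumrB.
  under eq_bigr do rewrite -scalerBl.
  have : (fun k => \sum_(0 <= i < n) (c K i - c k i) *: e_ i) @ \oo -->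
      \sum_(0 <= i < n) (c K i - a i) *: e_ i.
    apply: cvg_big => [|i _]; first exact: add_continuous.
    by apply: cvgZr_tmp; apply: cvgB; [exact: cvg_cst|exact: ca].
  move=> cl; apply: (norm_lim_le cl); exists K => // k /= Kk.
  apply: le_trans (emax_proj_le _ (leq_maxl n (size (w K - w k)))) _.
  under eq_bigr do rewrite -coefB.
  by rewrite emax_poly ?leq_maxr// to_Zmax_norm KP.
exists a; split=> //.
(* the difference of two expansions of [v] has partial sums tending to [0] *)
move=> a' a'v; apply/funext => i; apply/eqP; rewrite eq_sym -subr_eq0 -normr_le0.
have aa' : (fun n => \sum_(0 <= i < n) (a' i - a i) *: e_ i) @ \oo --> v - v.
  rewrite (_ : (fun n => _) = series (fun i => a' i *: e_ i) - series (fun i => a i *: e_ i)).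
    exact: cvgB a'v av.
  apply/funext => n; rewrite !fctE /series/= -sumrB.
  by apply: eq_bigr => j _; rewrite scalerBl.
have n0 := cvg_norm aa'; rewrite subrr normr0 in n0.
have l0 : (fun n => `|f_ i| * `|\sum_(0 <= i < n) (a' i - a i) *: e_ i|) @ \oo --> `|f_ i| * 0.
  by apply: cvgMl_tmp; exact: n0.
rewrite mulr0 in l0.
apply: ler_cvg_to (@cvg_cst R `|a' i - a i| _ \oo _) l0 _.
by exists i.+1 => // n /= i_n; exact: (@emax_coef_le (fun i => a' i - a i)).
Qed.

(** [e_ i |-> x_ i] extends to a bounded operator on the maximal space: a norming
    functional [g] yields the coefficients [g (x_ i)], whose sums against the [f_ i]
    are adjoint partial sums of the frame expansion. *)
Lemma emax_dominates : exists2 K : R, 0 < K & forall (a : nat -> R) m n,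
  `|\sum_(m <= i < n) a i *: x_ i| <= K * `|\sum_(m <= i < n) a i *: e_ i|.
Proof.
have [K K0 SK] := frame_bounded F; exists (K + 1) => [|a m n].
  by rewrite ltr_wpDl.
have K1 : 0 < K + 1 by rewrite ltr_wpDl.
have [g [gb gx]] := norming_functional (\sum_(m <= i < n) a i *: x_ i).
pose b i := (K + 1)^-1 * g (x_ i).
have bB : max_unit_ball F (truncate m n b).
  apply: truncate_ball => k l; apply: restr_norm_le => // x _; rewrite mul1r dual_sumE.
  have -> : \sum_(k <= i < l) b i * f_ i x = (K + 1)^-1 * g (\sum_(k <= i < l) f_ i x *: x_ i).
    rewrite linear_sum mulr_sumr; apply: eq_bigr => i _.
    by rewrite linearZ /b -mulrA; congr (_ * _); rewrite mulrC.
  rewrite normrM gtr0_norm ?invr_gt0// ler_pdivrMl// (le_trans (gb _))//.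
  by rewrite (le_trans (SK _ _ _))// ler_wpM2r// lerDl.
rewrite (le_trans gx)// (le_trans (ler_norm _))//.
have := emax_norm_ge a m n bB; rewrite -ler_pdivrMl//; apply: le_trans.
rewrite -[X in X * _]gtr0_norm ?invr_gt0// -normrM le_eqVlt; apply/orP; left; apply/eqP.
congr `|_|; rewrite linear_sum mulr_sumr big_nat [RHS]big_nat; apply: eq_bigr => i mi.
rewrite truncateE mi linearZ /b.
by rewrite [RHS]mulrCA.
Qed.

(** The [y (f_ i)] have bounded partial sums in the maximal space, as they are paired with
    sums of norm at most [1] in the span of the [f_ i]; convergence there is carried over
    to [X] by [emax_dominates]. *)
Lemma boundedly_complete_basis_cvg (y : dual (closed_span f_)) :
  boundedly_complete_basis e_ -> cvgn (series (fun i => y (closed_span_gen f_ i) *: x_ i)).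
Proof.
move=> [_ bc]; pose a i := y (closed_span_gen f_ i).
have /bc/cvg_cauchy/cauchy_seriesP ac :
    exists M : R, forall n, `|series (fun i => a i *: e_ i) n| <= M.
  exists (dual_norm y) => n; apply: emax_norm_le => b bB.
  have -> : \sum_(0 <= i < n) a i * b`_i = y (\sum_(0 <= i < n) b`_i *: closed_span_gen f_ i).
    rewrite linear_sum; apply: eq_bigr => i _.
    by rewrite linearZ mulrC.
  rewrite (le_trans (dual_norm_bound _ _))// ler_piMr ?dual_norm_ge0//.
  by rewrite closed_span_normE closed_span_val_sum max_unit_ball_sum.
have [K K0 xe] := emax_dominates.
apply/cauchy_cvgP/cauchy_seriesP => e e0.
apply: filterS (ac _ (divr_gt0 e0 K0)) => -[m n] /= mn.
by apply: le_lt_trans (xe a m n) _; rewrite mulrC -ltr_pdivlMr.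
Qed.

(** When [y] is the image of [x], its series is the frame expansion of [x]. *)
Lemma canonical_map_iso_cvg (y : dual (closed_span f_)) :
  linear_isomorphism (canonical_map F) ->
  cvgn (series (fun i => y (closed_span_gen f_ i) *: x_ i)).
Proof.
move=> [_ [S [_ SK _ _]]]; apply/cvg_ex; exists (S y).
rewrite -{1}(SK y); exact: frame_expansion.
Qed.

(** On the span of the [f_ i], [g] is the evaluation at some [x]. Up to a small error, [x]
    is a finite combination of the [x_ k], and these are small on far blocks by local
    bounded completeness. *)
Lemma canonical_map_iso_shrinking : locally_boundedly_complete F ->
  linear_isomorphism (canonical_map F) ->
  forall (g : dual (dual X)) (d : R), 0 < d -> exists n, forall p,
    supported_from n p -> prefixes_le f_ 1 p -> g (lincomb f_ p) < d.
Proof.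
move=> lbc [_ [S [_ SK _ _]]] g d d0.
have [y yg] := closed_span_dual_restrict f_ g; pose x := S y.
have gx i : g (f_ i) = f_ i x.
  have /(congr1 (fun y : dual (closed_span f_) => y (closed_span_gen f_ i))) := SK y.
  by rewrite yg.
have d2 : 0 < d / 2 by rewrite divr_gt0.
have /cvgrPdist_le/(_ _ d2)[m _ /(_ m (leqnn m)) xm] := @frame_expansion _ _ F x.
pose r n := \sum_(0 <= k < m) `|f_ k x| * restr_norm (bidual_eval (x_ k)) (span_from f_ n).
have r0 : r @ \oo --> 0.
  rewrite [X in _ --> X](_ : _ = \sum_(0 <= k < m) `|f_ k x| * 0).
    apply: cvg_big => [|k _]; first exact: add_continuous.
    exact: cvgMl_tmp.
  by rewrite big1// => k _; rewrite mulr0.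
have /cvgrPdist_lt/(_ _ d2)[n _ /(_ n (leqnn n)) rn] := r0.
exists n => p sp pp; pose N := maxn n (size p); pose h := lincomb f_ p.
have hE : h = \sum_(0 <= i < N) p`_i *: f_ i by rewrite /h (lincombE _ (leq_maxr n _)).
have hspan : span_from f_ n h.
  rewrite hE (big_cat_nat (leq0n n) (leq_maxl _ _))/= [X in X + _]big_nat.
  rewrite [X in X + _]big1 ?add0r => [|i /andP[_ ni]]; last by rewrite sp// scale0r.
  exact: span_from_sum.
have h1 : `|h| <= 1 by exact: pp.
have -> : g (lincomb f_ p) = h x.
  rewrite hE dual_sumE (lincombE _ (leq_maxr n _)) linear_sum.
  by apply: eq_bigr => i _; rewrite -gx linearZ.
rewrite -[x](subrK (series (fun i => f_ i x *: x_ i) m)) linearD (splitr d).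
apply: ler_ltD.
  apply: le_trans (ler_norm _) _; apply: le_trans (dual_norm_bound _ _) _.
  by apply: le_trans (ler_wpM2r (normr_ge0 _) h1) _; rewrite mul1r.
move: rn; rewrite sub0r normrN; apply: le_lt_trans; apply: le_trans (ler_norm _).
rewrite /series/= linear_sum; apply: ler_sum => k _.
rewrite linearZ; apply: le_trans (ler_norm _) _; rewrite normrM ler_wpM2l//.
apply: le_trans (restr_norm_span (bidual_eval (x_ k)) hspan) _.
by rewrite ler_piMr// restr_norm_span_ge0.
Qed.

(** Coefficients with bounded partial sums act as a bounded functional on finite sequences
    [p] normed by the sums [\sum p`_i *: f_ i]; by [shrinking] it is uniformly small on far
    blocks, which is the Cauchy criterion in the maximal norm. *)
Lemma emax_boundedly_complete : locally_boundedly_complete F ->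
  linear_isomorphism (canonical_map F) -> boundedly_complete_basis e_.
Proof.
move=> lbc iso; split; first exact: emax_basis.
move=> a [M aM].
have sumN (b : {poly R}) k l :
    \sum_(k <= i < l) (- b)`_i *: f_ i = - \sum_(k <= i < l) b`_i *: f_ i.
  by rewrite -sumrN; apply: eq_bigr => i _; rewrite coefN scaleNr.
(* a segment is the difference of two prefixes, whence the factor 2 *)
have phiM p r : 0 < r -> prefixes_le f_ r p -> lincomb (a : nat -> R^o) p <= 2 * M * r.
  move=> r0 pr; have r2 : 0 < 2 * r by rewrite mulr_gt0.
  have bB : max_unit_ball F (truncate 0 (size p) (fun i => (2 * r)^-1 * p`_i)).
    apply: truncate_ball => k l; under eq_bigr do rewrite -scalerA.
    rewrite -scaler_sumr normrZ gtr0_norm ?invr_gt0// ler_pdivrMl// mulr1.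
    have [kl|/ltnW lk] := leqP k l; last by rewrite big_geq// normr0 ltW.
    have -> : \sum_(k <= i < l) p`_i *: f_ i =
        \sum_(0 <= i < l) p`_i *: f_ i - \sum_(0 <= i < k) p`_i *: f_ i.
      by rewrite (big_cat_nat (leq0n k) kl)/= addrAC subrr add0r.
    by rewrite (le_trans (ler_normB _ _))// mulr_natl mulr2n lerD.
  have := le_trans (emax_norm_ge a 0 (size p) bB) (aM (size p)).
  move=> /(le_trans (ler_norm _)).
  have -> : \sum_(0 <= i < size p) a i * (truncate 0 (size p) (fun i => (2 * r)^-1 * p`_i))`_i
      = (2 * r)^-1 * lincomb (a : nat -> R^o) p.
    rewrite mulr_sumr big_nat [RHS]big_nat; apply: eq_bigr => i ip.
    by rewrite truncateE ip -[_ *: _]/(_ * _) mulrCA [a i * _]mulrC.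
  by rewrite ler_pdivrMl// mulrAC.
have small := shrinking (canonical_map_iso_shrinking lbc iso) phiM.
apply/cauchy_cvgP/cauchy_seriesP => e e0.
have [n nP] := small _ (divr_gt0 e0 (ltr0n R 2)).
exists ([set k | (n <= k)%N], [set l | (n <= l)%N]); first by split; exists n.
move=> [k l] [/= nk nl]; apply: (@le_lt_trans _ _ (e / 2)); last by lra.
have ab b : max_unit_ball F b -> \sum_(k <= i < l) a i * b`_i <= e / 2.
  move=> bB; pose T := truncate k l (fun i => b`_i).
  have <- : lincomb (a : nat -> R^o) T = \sum_(k <= i < l) a i * b`_i.
    rewrite (@lincombE _ _ _ _ l) ?size_poly// truncate_sum max0n minnn.
    by apply: eq_bigr => i _; rewrite -[_ *: _]/(_ * _) mulrC.
  apply: nP => [i i_n|q].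
    by rewrite truncateE leqNgt (leq_trans i_n nk).
  by rewrite truncate_sum max_unit_ball_sum.
apply: emax_norm_le => b bB; rewrite ler_norml ab// andbT lerNl.
have bNB : max_unit_ball F (- b) by move=> i j ij; rewrite sumN normrN; exact: bB.
apply: le_trans (ab _ bNB); rewrite -sumrN le_eqVlt; apply/orP; left; apply/eqP.
by apply: eq_bigr => i _; rewrite coefN mulrN.
Qed.

End MaximalBasis.

Theorem theoremB (R : realType) (X : completeNormedModType R)
    (F : schauder_frame X)
    (hshrink : forall m : nat,
      restr_norm (frame_fun F m) (span_from (frame_vec F) n) @[n --> \oo] --> (0 : R))
    (hbc : forall m : nat,
      restr_norm (bidual_eval (frame_vec F m)) (span_from (frame_fun F) n)
        @[n --> \oo] --> (0 : R)) :
  (boundedly_complete_frame F <-> linear_isomorphism (canonical_map F)) /\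
  (linear_isomorphism (canonical_map F) <-> boundedly_complete_basis (emax F)).
Proof.
split; split.
- move=> [_ pbc]; apply: canonical_map_iso => // y.
  have [xss xssy] := closed_span_dual_extend y.
  by under eq_fun do rewrite -xssy; exact: pbc.
- move=> iso; split=> // xss.
  have [y yxss] := closed_span_dual_restrict (frame_fun F) xss.
  have := @canonical_map_iso_cvg _ _ F y iso.
  by under eq_fun do rewrite yxss.
- exact: emax_boundedly_complete.
- by move=> bc; apply: canonical_map_iso => // y; exact: boundedly_complete_basis_cvg.
Qed.
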